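(* Let $(\tau_1,\tau_2)$ be $\operatorname{CDPH}(\bm{\alpha},\bm{P},\bm{U},\bm{Q}_1,\bm{Q}_2)$ distributed. Let $\{(X_{1,\ell},X_{2,\ell})\}_{\ell\ge1}$ be an i.i.d. sequence of bivariate random vectors with positive components, distributed as $(X_1,X_2)$ and independent of $(\tau_1,\tau_2)$, and let $Y_1:=\sum_{\ell=1}^{\tau_1}X_{1,\ell}$, $Y_2:=\sum_{\ell=1}^{\tau_2}X_{2,\ell}$. If $X_1$ and $X_2$ follow independent matrix-exponential distributions, then $(Y_1,Y_2)$ belongs to the class of multivariate matrix-exponential (MME) distributions.
   Context: CDPH. $\mathcal{E}$ and $\mathcal{S}$ are disjoint nonempty finite sets. $\bm{\alpha}$ is a probability row vector indexed by $\mathcal{E}$; $\bm{P}$ is a subprobability matrix (nonnegative entries, row sums at most $1$) on $\mathcal{E}$; $\bm{U}$ is a nonnegative $\mathcal{E}\times\mathcal{S}$ matrix such that each row of $(\bm{P}\ \bm{U})$ sums to one; $\bm{Q}_1,\bm{Q}_2$ are subprobability matrices on $\mathcal{S}$. All chains terminate almost surely (from every state), i.e. all eigenvalues of $\bm{P},\bm{Q}_1,\bm{Q}_2$ have modulus strictly less than $1$. $M_1$ is a terminating Markov chain (time $n=0,1,2,\dots$) on $\mathcal{E}\cup\mathcal{S}$ with initial vector $(\bm{\alpha},\bm{0})$ and subprobability transition matrix $\begin{pmatrix}\bm{P}&\bm{U}\\ \bm{0}&\bm{Q}_1\end{pmatrix}$ (the missing mass in a row is the probability of terminating at the next step). Let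 $\tau_{1,2}:=\inf\{n\ge 1: M_1(n)\notin\mathcal{E}\}$. Set $M_2(n)=M_1(n)$ for $n\le\tau_{1,2}$; after time $\tau_{1,2}$, given the past up to $\tau_{1,2}$, $M_2$ evolves independently of $M_1$ as a terminating Markov chain in $\mathcal{S}$ with subprobability matrix $\bm{Q}_2$. For $k\in\{1,2\}$, $\tau_k:=\inf\{n\ge 1: M_k(n)\notin\mathcal{E}\cup\mathcal{S}\}$. The law of $(\tau_1,\tau_2)$ is called $\operatorname{CDPH}(\bm{\alpha},\bm{P},\bm{U},\bm{Q}_1,\bm{Q}_2)$. A (univariate) matrix-exponential distribution is a distribution of a positive random variable $X$ whose Laplace transform $\theta\mapsto\mathbb{E}(e^{-\theta X})$, $\theta\ge0$, is a rational function of $\theta$. A bivariate random vector $(Y_1,Y_2)$ with nonnegative components is MME if its joint Laplace transform $(\theta_1,\theta_2)\mapsto\mathbb{E}(e^{-\theta_1Y_1-\theta_2Y_2})$, $\theta_1,\theta_2\ge0$, is a rational function (a ratio of two polynomials) in $(\theta_1,\theta_2)$. *)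

(* Defs.v *)
From HB Require Import structures.
From mathcomp Require Import all_boot all_order all_algebra.
From mathcomp Require Import all_classical all_reals all_analysis.
From mathcomp Require Import complex.

Set Implicit Arguments.
Unset Strict Implicit.
Unset Printing Implicit Defensive.

Import Order.TTheory GRing.Theory Num.Theory.
Import numFieldNormedType.Exports.

Local Open Scope classical_set_scope.
Local Open Scope ring_scope.

Section MatrixParameters.
Context {R : realType}.

Definition subprobability_mx n (A : 'M[R]_n) : Prop :=
  (forall i j, 0 <= A i j) /\ (forall i, \sum_j A i j <= 1).

Definition terminating_mx n (A : 'M[R]_n) : Prop :=
  forall z : complex R,
    eigenvalue (map_mx (real_complex R) A) z -> `|z| < 1.

Definition cdph_parameters p q (alpha : 'rV[R]_p) (P : 'M[R]_p)
    (U : 'M[R]_(p, q)) (Q1 Q2 : 'M[R]_q) : Prop :=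
  [/\ (0 < p)%N /\ (0 < q)%N,
      (forall i, 0 <= alpha 0 i) /\ \sum_i alpha 0 i = 1,
      [/\ subprobability_mx P, subprobability_mx Q1 & subprobability_mx Q2],
      (forall i j, 0 <= U i j) /\ (forall i, \sum_j row_mx P U i j = 1) &
      [/\ terminating_mx P, terminating_mx Q1 & terminating_mx Q2]].

(* A terminating chain with states 'I_n is a process in option 'I_n, where
   None is the absorbing state "terminated"; it receives the missing mass of
   each row. *)
Definition transition n (A : 'M[R]_n) (x y : option 'I_n) : R :=
  match x, y with
  | Some i, Some j => A i j
  | Some i, None => 1 - \sum_j A i j
  | None, Some _ => 0
  | None, None => 1
  end.

End MatrixParameters.

Section Chains.
Context {R : realType} {d : measure_display} {T : measurableType d}.
Variable Pr : probability T R.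

Definition cylinder {X : Type} (M : nat -> T -> X) (h : nat -> X) (k : nat) :
  set T := [set w | forall j, (j <= k)%N -> M j w = h j].

(* Under Pr conditioned on D, the process M is a terminating chain with
   transition matrix A (the common factor 1 / Pr D is cleared, so nothing is
   required when Pr D = 0). *)
Definition markov_given (D : set T) n (A : 'M[R]_n)
    (M : nat -> T -> option 'I_n) : Prop :=
  forall (h : nat -> option 'I_n) (k : nat),
    Pr (D `&` cylinder M h k.+1) =
    (Pr (D `&` cylinder M h k) * (transition A (h k) (h k.+1))%:E)%E.

Definition hitting_time {X : Type} (A : set X) (x : nat -> X) : \bar R :=
  ereal_inf [set n%:R%:E | n in [set n : nat | (1 <= n)%N /\ A (x n)]].

(* The state space E + S is 'I_(p + q): states below p are those of E. *)
Definition in_E p q : set (option 'I_(p + q)) :=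
  [set x | exists i : 'I_p, x = Some (lshift q i)].

Definition termination_time n (M : nat -> T -> option 'I_n) (w : T) : \bar R :=
  hitting_time [set None] (M ^~ w).

Definition exit_E p q (M : nat -> T -> option 'I_(p + q)) (w : T) : \bar R :=
  hitting_time (~` @in_E p q) (M ^~ w).

(* The last two clauses condition on {tau_{1,2} = t} and on the path h of M1
   up to time t.  Since the state at time t is outside E, the zero rows of the
   matrix for M2 play no role. *)
Definition cdph_chains p q (alpha : 'rV[R]_p) (P : 'M[R]_p) (U : 'M[R]_(p, q))
    (Q1 Q2 : 'M[R]_q) (M1 M2 : nat -> T -> option 'I_(p + q)) : Prop :=
  [/\ forall n x, measurable (M1 n @^-1` [set x]) /\
                  measurable (M2 n @^-1` [set x]),
      forall i, Pr (M1 0%N @^-1` [set Some i]) =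
                ((row_mx alpha (0 : 'rV[R]_q)) 0 i)%:E,
      markov_given setT (block_mx P U 0 Q1) M1,
      forall w n, (n%:R%:E <= exit_E M1 w)%E -> M2 n w = M1 n w &
      forall (t : nat) (h : nat -> option 'I_(p + q)),
        let D := [set w | exit_E M1 w = t%:R%:E] `&` cylinder M1 h t in
        let N1 j := M1 (t + j)%N in
        let N2 j := M2 (t + j)%N in
        markov_given D (block_mx 0 0 0 Q2) N2 /\
        forall f g k l,
          (Pr (D `&` (cylinder N1 f k `&` cylinder N2 g l)) * Pr D =
           Pr (D `&` cylinder N1 f k) * Pr (D `&` cylinder N2 g l))%E].

End Chains.

(* The law is carried by pairs of positive integers, as both chains terminate
   almost surely; hence tau1 and tau2 are taken with values in nat. *)
Definition cdph {R : realType} {d} {T : measurableType d}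
    (Pr : probability T R) (tau1 tau2 : {RV Pr >-> nat})
    p q (alpha : 'rV[R]_p) (P : 'M[R]_p) (U : 'M[R]_(p, q))
    (Q1 Q2 : 'M[R]_q) : Prop :=
  exists (d' : measure_display) (T' : measurableType d')
    (Pr' : probability T' R) (M1 M2 : nat -> T' -> option 'I_(p + q)),
    cdph_chains Pr' alpha P U Q1 Q2 M1 M2 /\
    forall m n : nat,
      Pr [set w | tau1 w = m /\ tau2 w = n] =
      Pr' [set w | termination_time M1 w = m%:R%:E :> \bar R /\
                   termination_time M2 w = n%:R%:E :> \bar R].

Section Independence.
Context {R : realType} {d : measure_display} {T : measurableType d}.
Variable Pr : probability T R.

Definition sigma_rv {d'} {X : measurableType d'} (V : T -> X) : set (set T) :=
  preimage_set_system setT V measurable.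

Definition sigma_seq {d'} {X : measurableType d'} (V : nat -> T -> X) :
  set (set T) := <<s \bigcup_l sigma_rv (V l) >>.

Definition independent2 (F G : set (set T)) : Prop :=
  forall A B, F A -> G B -> Pr (A `&` B) = (Pr A * Pr B)%E.

Definition mutually_independent {I : choiceType} (F : I -> set (set T)) :
  Prop :=
  forall (s : seq I) (A : I -> set T), uniq s ->
    (forall i, i \in s -> F i (A i)) ->
    Pr (\bigcap_(i in [set` s]) A i) = (\prod_(i <- s) Pr (A i))%E.

End Independence.

Definition iid_copies {R : realType} {d d0} {T : measurableType d}
    {T0 : measurableType d0} (Pr : probability T R) (Pr0 : probability T0 R)
    {dX} {X : measurableType dX} (V : nat -> T -> X) (V0 : T0 -> X) : Prop :=
  mutually_independent Pr (fun l => sigma_rv (V l)) /\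
  forall l (B : set X), measurable B -> Pr (V l @^-1` B) = Pr0 (V0 @^-1` B).

Section MatrixExponential.
Context {R : realType} {d : measure_display} {T : measurableType d}.
Variable Pr : probability T R.

Definition matrix_exponential (X : T -> R) : Prop :=
  [/\ measurable_fun setT X,
      {ae Pr, forall w, 0 < X w} &
      exists num den : {poly R}, forall theta : R, 0 <= theta ->
        den.[theta] != 0 /\
        ('E_Pr[fun w => expR (- theta * X w)])%E =
        (num.[theta] / den.[theta])%:E].

(* Polynomials in (theta1, theta2) are elements of {poly {poly R}}: the
   coefficients are polynomials in theta2. *)
Definition MME (Y1 Y2 : T -> R) : Prop :=
  [/\ measurable_fun setT Y1 /\ measurable_fun setT Y2,
      {ae Pr, forall w, 0 <= Y1 w /\ 0 <= Y2 w} &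
      exists num den : {poly {poly R}}, forall theta1 theta2 : R,
        0 <= theta1 -> 0 <= theta2 ->
        den.[theta1%:P].[theta2] != 0 /\
        ('E_Pr[fun w => expR (- theta1 * Y1 w - theta2 * Y2 w)])%E =
        (num.[theta1%:P].[theta2] / den.[theta1%:P].[theta2])%:E].

End MatrixExponential.

(* Main.v *)
Require Import Defs.
From HB Require Import structures.
From mathcomp Require Import all_boot all_order all_algebra.
From mathcomp Require Import all_classical all_reals all_analysis.
From mathcomp Require Import measurable_realfun complex ring.

(** The joint transform of the random sums is computed in closed form and seen
to be rational.

Fix theta1, theta2 >= 0 and let x and y be the Laplace transforms of X1 at
theta1 and of X2 at theta2: rational functions with values in [0, 1].
Conditioning on (tau1, tau2) = (m, n) and using that the copies are i.i.d.,
independent of the stopping times and with independent coordinates, the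
transform of (Y1, Y2) is the bivariate probability generating function
[sum_(m, n) Pr(tau1 = m, tau2 = n) x^m y^n] ([laplace_random_sums]).

Split the event {tau1 = m, tau2 = n} according to the time t and the state i in
which the common chain leaves E.  After that time the two chains are
conditionally independent and absorbed according to two discrete phase-type
laws started in i, so that the joint law is a sum over t and i of products
[a_i(t) c1_i(m - t) c2_i(n - t)] ([joint_law]), with
[a_i(t+1) = (alpha P^t U)_i] and [c_i(k+1) = (Q^k (1 - Q 1))_i].  The
generating function of such a convolution is
[sum_i A_i(x y) C1_i(x) C2_i(y)] ([gf_convolution]), where each factor has the
form [z v (1 - z M)^-1 W] ([resolvent_series]).

It remains to see that this is rational in (theta1, theta2).  The entries of
[(1 - z M)^-1 = adj(1 - z M) / det(1 - z M)] are rational in z, and the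
determinant does not vanish for z in [0, 1], since otherwise 1 / z >= 1 would
be an eigenvalue of M ([terminating_det_neq0]).  Substituting the rational
functions x, y and x y for z keeps everything rational
([cdph_gf_rational]). *)

Import Order.TTheory GRing.Theory Num.Theory.
Import numFieldNormedType.Exports.
Local Open Scope classical_set_scope.
Local Open Scope ring_scope.
Set Implicit Arguments.
Unset Strict Implicit.

(** * Rational functions of two variables *)

Section RationalFunctions.
Context {R : realType}.

(** Ratios of two polynomials on the closed first quadrant, in the encoding of
bivariate polynomials by polynomials whose coefficients are polynomials in the
second variable.  As a property of functions rather than of fractions, it is
preserved by inversion as soon as the function has no zero, which is how matrix
inverses are reached. *)
Definition rational2 (f : R -> R -> R) : Prop :=
  exists num den : {poly {poly R}}, forall s t : R, 0 <= s -> 0 <= t ->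
    den.[s%:P].[t] != 0 /\ f s t = num.[s%:P].[t] / den.[s%:P].[t].

Lemma rational2_cst (c : R) : rational2 (fun _ _ => c).
Proof.
exists c%:P%:P, 1 => s t _ _.
by rewrite !hornerE oner_neq0 divr1.
Qed.

Lemma rational2_fst (f : R -> R) (num den : {poly R}) :
  (forall s, 0 <= s -> den.[s] != 0 /\ f s = num.[s] / den.[s]) ->
  rational2 (fun s _ => f s).
Proof.
move=> H; exists (map_poly polyC num), (map_poly polyC den) => s t s0 _.
by rewrite !horner_map /= !hornerC; exact: H.
Qed.

Lemma rational2_snd (f : R -> R) (num den : {poly R}) :
  (forall s, 0 <= s -> den.[s] != 0 /\ f s = num.[s] / den.[s]) ->
  rational2 (fun _ t => f t).
Proof.
by move=> H; exists num%:P, den%:P => s t _ t0; rewrite !hornerC; exact: H.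
Qed.

Lemma rational2D f g : rational2 f -> rational2 g ->
  rational2 (fun s t => f s t + g s t).
Proof.
move=> [n [d H]] [n' [d' H']]; exists (n * d' + n' * d), (d * d') => s t s0 t0.
have [d0 ->] := H s t s0 t0; have [d0' ->] := H' s t s0 t0.
by rewrite !hornerE mulf_neq0// addf_div.
Qed.

Lemma rational2M f g : rational2 f -> rational2 g ->
  rational2 (fun s t => f s t * g s t).
Proof.
move=> [n [d H]] [n' [d' H']]; exists (n * n'), (d * d') => s t s0 t0.
have [d0 ->] := H s t s0 t0; have [d0' ->] := H' s t s0 t0.
by rewrite !hornerM mulf_neq0// mulf_div.
Qed.

(** The inverse exchanges numerator and denominator; the numerator takes no zero
on the quadrant exactly because f does not. *)
Lemma rational2V f : rational2 f ->
  (forall s t, 0 <= s -> 0 <= t -> f s t != 0) ->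
  rational2 (fun s t => (f s t)^-1).
Proof.
move=> [n [d H]] f0; exists d, n => s t s0 t0.
have := f0 s t s0 t0; have [d0 ->] := H s t s0 t0.
by rewrite mulf_eq0 negb_or invf_div => /andP[].
Qed.

Lemma rational2_sum (I : Type) (r : seq I) (f : I -> R -> R -> R) :
  (forall i, rational2 (f i)) -> rational2 (fun s t => \sum_(i <- r) f i s t).
Proof.
move=> H; elim: r => [|i r IH].
  by under eq_fun do under eq_fun do rewrite big_nil; exact: rational2_cst.
by under eq_fun do under eq_fun do rewrite big_cons; exact: rational2D.
Qed.

Lemma rational2_prod (I : Type) (r : seq I) (f : I -> R -> R -> R) :
  (forall i, rational2 (f i)) -> rational2 (fun s t => \prod_(i <- r) f i s t).
Proof.
move=> H; elim: r => [|i r IH].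
  by under eq_fun do under eq_fun do rewrite big_nil; exact: rational2_cst.
by under eq_fun do under eq_fun do rewrite big_cons; exact: rational2M.
Qed.

Definition rational2_mx m n (A : R -> R -> 'M[R]_(m, n)) : Prop :=
  forall i j, rational2 (fun s t => A s t i j).

Lemma rational2_det n (A : R -> R -> 'M[R]_n) :
  rational2_mx A -> rational2 (fun s t => \det (A s t)).
Proof.
move=> H; apply: rational2_sum => sg; apply: rational2M; first exact: rational2_cst.
by apply: rational2_prod => i; exact: H.
Qed.

Lemma rational2_mulmx m n l (A : R -> R -> 'M[R]_(m, n))
    (B : R -> R -> 'M[R]_(n, l)) : rational2_mx A -> rational2_mx B ->
  rational2_mx (fun s t => A s t *m B s t).
Proof.
move=> HA HB i j.
under eq_fun do under eq_fun do rewrite mxE.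
by apply: rational2_sum => k; exact: rational2M.
Qed.

Lemma rational2_mxcst m n (A : 'M[R]_(m, n)) : rational2_mx (fun _ _ => A).
Proof. by move=> i j; exact: rational2_cst. Qed.

(** Cramer's rule: the inverse is the adjugate, a matrix of signed minors,
divided by the determinant. *)
Lemma rational2_invmx n (A : R -> R -> 'M[R]_n) : rational2_mx A ->
  (forall s t, 0 <= s -> 0 <= t -> \det (A s t) != 0) ->
  rational2_mx (fun s t => (\det (A s t))^-1 *: \adj (A s t)).
Proof.
move=> HA H0 i j.
under eq_fun do under eq_fun do rewrite !mxE /cofactor.
apply: rational2M; first by apply: rational2V => //; exact: rational2_det.
apply: rational2M; first exact: rational2_cst.
apply: rational2_det => k l.
under eq_fun do under eq_fun do rewrite !mxE.
exact: HA.
Qed.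

Lemma rational2_resolvent n (M : 'M[R]_n) (z : R -> R -> R) : rational2 z ->
  rational2_mx (fun s t => 1%:M - z s t *: M).
Proof.
move=> Hz i j.
under eq_fun do under eq_fun do rewrite !mxE.
apply: rational2D; first exact: rational2_cst.
under eq_fun do under eq_fun do rewrite -mulrN.
by apply: rational2M => //; exact: rational2_cst.
Qed.

(** A kernel vector of 1 - z M with z > 0 is an eigenvector of M for the
eigenvalue 1 / z >= 1, which the spectral condition excludes. *)
Lemma terminating_det_neq0 n (M : 'M[R]_n) (z : R) : terminating_mx M ->
  0 <= z <= 1 -> \det (1%:M - z *: M) != 0.
Proof.
move=> tM /andP[z0 z1].
have [->|zn0] := eqVneq z 0; first by rewrite scale0r subr0 det1 oner_neq0.
apply/negP => /det0P[v v0 vM].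
have vM' : v *m M = z^-1 *: v.
  move: vM; rewrite mulmxBr mulmx1 -scalemxAr => /eqP; rewrite subr_eq0 => /eqP e.
  by rewrite [in RHS]e scalerA mulVf// scale1r.
have /tM : eigenvalue (map_mx (real_complex R) M) (real_complex R z^-1).
  apply/eigenvalueP; exists (map_mx (real_complex R) v).
    by rewrite -map_mxM vM' map_mxZ.
  by rewrite map_mx_eq0.
have zV : 1 <= z^-1 by rewrite invf_ge1// lt_neqAle eq_sym zn0.
rewrite normc_def /= expr0n addr0 sqrtr_sqr ger0_norm; last by rewrite invr_ge0.
by rewrite ltcR => /lt_geF; rewrite zV.
Qed.

End RationalFunctions.

(** * Power series of a substochastic matrix *)

Section MatrixSeries.
Context {R : realType} (n r : nat) (M : 'M[R]_n) (W : 'M[R]_(n, r)).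
Hypothesis M0 : forall i j, 0 <= M i j.
Hypothesis W0 : forall i j, 0 <= W i j.
Hypothesis MW1 : forall i, \sum_j M i j + \sum_j W i j = 1.

Lemma expmx_ge0 k i j : 0 <= (M ^+ k) i j.
Proof.
elim: k i j => [|k IH] i j; first by rewrite expr0 mxE; case: eqP.
by rewrite exprS mxE sumr_ge0// => l _; rewrite mulr_ge0.
Qed.

Lemma expmx_mul_ge0 k i j : 0 <= (M ^+ k *m W) i j.
Proof. by rewrite mxE sumr_ge0// => l _; rewrite mulr_ge0// expmx_ge0. Qed.

(** As W 1 = 1 - M 1, the row sums of the M^k W telescope to 1 - M^N 1.  In terms
of chains: M^k W is the law of the state entered when leaving at time k + 1, so
these numbers are probabilities of disjoint events. *)
Lemma sum_expmx_mul_le1 N i j : \sum_(k < N) (M ^+ k *m W) i j <= 1.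
Proof.
have W1 : W *m const_mx 1 = const_mx 1 - M *m const_mx 1 :> 'cV[R]_n.
  apply/matrixP => a b; rewrite !mxE.
  under eq_bigr do rewrite mxE mulr1.
  under [in RHS]eq_bigr do rewrite mxE mulr1.
  by rewrite -[X in X - _](MW1 a) addrAC subrr add0r.
have -> : \sum_(k < N) (M ^+ k *m W) i j = (\sum_(k < N) (M ^+ k *m W)) i j.
  by rewrite summxE.
have tele : (\sum_(k < N) (M ^+ k *m W)) *m const_mx 1 =
            const_mx 1 - M ^+ N *m const_mx 1 :> 'cV[R]_n.
  elim: N => [|N IH]; first by rewrite big_ord0 mul0mx expr0 mul1mx subrr.
  rewrite big_ord_recr mulmxDl IH -mulmxA W1 mulmxBr mulmxA exprSr.
  by rewrite -mulmxE addrA subrK.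
have S0 a b : 0 <= (\sum_(k < N) (M ^+ k *m W)) a b.
  by rewrite summxE sumr_ge0// => k _; exact: expmx_mul_ge0.
have /matrixP/(_ i 0) := tele; rewrite !mxE (bigD1 j)//= mxE mulr1 => e.
rewrite (@le_trans _ _ (1 - \sum_j0 (M ^+ N) i j0 * (const_mx 1 : 'cV[R]_n) j0 0))//.
  by rewrite -e lerDl sumr_ge0// => l _; rewrite mxE mulr1.
by rewrite gerBl sumr_ge0// => l _; rewrite mxE mulr1 expmx_ge0.
Qed.

(** The series G converges by the uniform bound on its partial sums and satisfies
G = W + z M G, a linear system that Cramer's rule solves.  Summing in the
extended reals allows the rearrangement before convergence is discussed. *)
Lemma resolvent_series (z : R) i j : 0 <= z <= 1 ->
  \det (1%:M - z *: M) != 0 ->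
  (\sum_(0 <= k <oo) (z ^+ k * (M ^+ k *m W) i j)%:E)%E =
  (((\det (1%:M - z *: M))^-1 *: \adj (1%:M - z *: M) *m W) i j)%:E.
Proof.
move=> /andP[z0 z1] det0.
pose F i j := (\sum_(0 <= k <oo) (z ^+ k * (M ^+ k *m W) i j)%:E)%E.
have t0 k a b : (0 <= (z ^+ k * (M ^+ k *m W) a b)%:E)%E.
  by rewrite lee_fin mulr_ge0 ?exprn_ge0 ?expmx_mul_ge0.
have Fle a b : (F a b <= 1)%E.
  apply: lime_le; first by apply: is_cvg_nneseries => k _ _.
  near=> N; rewrite sumEFin lee_fin big_mkord.
  apply: (le_trans _ (sum_expmx_mul_le1 N a b)); apply: ler_sum => k _.
  by rewrite ler_piMl ?expmx_mul_ge0// exprn_ile1.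
have F0 a b : (0 <= F a b)%E by apply: nneseries_ge0.
have Ffin a b : F a b \is a fin_num.
  by rewrite ge0_fin_numE// (le_lt_trans (Fle a b))// ltry.
pose G := \matrix_(a, b) fine (F a b).
have FG a b : F a b = (G a b)%:E by rewrite mxE fineK.
have rec : G = W + z *: (M *m G).
  apply/matrixP => a b; apply: EFin_inj; rewrite -FG [in LHS]/F.
  rewrite nneseries_recl//= expr0 expr0 mul1r mul1mx !mxE EFinD; congr (_ + _)%E.
  rewrite -nneseries_addn//.
  under eq_eseriesr => k _.
    rewrite addn1 exprS exprS -[M * M ^+ k]/(M *m M ^+ k) -mulmxA mxE.
    rewrite -mulrA mulr_sumr EFinM -sumEFin.
    over.
  rewrite nneseriesZl; last first.
    move=> k _; apply: sume_ge0 => l _.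
    by rewrite lee_fin !mulr_ge0// ?exprn_ge0// expmx_mul_ge0.
  rewrite EFinM; congr (_ * _)%E.
  rewrite nneseries_sum; last first.
    by move=> l k _; rewrite lee_fin !mulr_ge0// ?exprn_ge0// expmx_mul_ge0.
  rewrite -sumEFin; apply: eq_bigr => l _.
  rewrite EFinM -FG -nneseriesZl//; apply: eq_eseriesr => k _.
  by rewrite -EFinM mulrCA.
have GW : (1%:M - z *: M) *m G = W.
  by rewrite mulmxBl mul1mx -scalemxAl {1}rec addrK.
rewrite -/(F i j) FG -GW; congr (_ %:E).
by rewrite -scalemxAl mulmxA mul_adj_mx mul_scalar_mx scalerA mulVf// scale1r.
Unshelve. all: by end_near.
Qed.

Lemma resolvent_series_row (v : 'rV[R]_n) (z : R) j : 0 <= z <= 1 ->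
  (forall i, 0 <= v 0 i) -> \det (1%:M - z *: M) != 0 ->
  (\sum_(0 <= k <oo) (z ^+ k * (v *m M ^+ k *m W) 0 j)%:E)%E =
  ((v *m ((\det (1%:M - z *: M))^-1 *: \adj (1%:M - z *: M) *m W)) 0 j)%:E.
Proof.
move=> z01 v0 det0; have /andP[z0 _] := z01.
under eq_eseriesr => k _.
  rewrite -mulmxA mxE mulr_sumr -sumEFin.
  over.
rewrite nneseries_sum; last first.
  by move=> l k _; rewrite lee_fin !mulr_ge0// ?exprn_ge0// expmx_mul_ge0.
rewrite mxE -sumEFin; apply: eq_bigr => l _.
rewrite EFinM -resolvent_series// -nneseriesZl//; last first.
  by move=> k _; rewrite lee_fin !mulr_ge0// ?exprn_ge0// expmx_mul_ge0.
by apply: eq_eseriesr => k _; rewrite -EFinM mulrCA.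
Qed.

End MatrixSeries.

(** * Paths of chains with finitely many states *)

Section FiniteValued.
Context {R : realType} {d : measure_display} {T : measurableType d}.
Variable Pr : probability T R.

Definition finite_rv (F : finType) (g : T -> F) : Prop :=
  forall x, measurable (g @^-1` [set x]).

Lemma finite_rv_event (F : finType) (g : T -> F) (B : F -> Prop) :
  finite_rv g -> measurable [set w | B (g w)].
Proof.
move=> mg; have -> : [set w | B (g w)] = \bigcup_(x in [set x | B x]) g @^-1` [set x].
  by apply/seteqP; split=> [w Bw|w [x /= Bx /= ->]]//; exists (g w).
by apply: fin_bigcup_measurable => // x _; exact: mg.
Qed.

Definition prob (A : set T) : R := fine (Pr A).

Lemma probE A : measurable A -> Pr A = (prob A)%:E.
Proof. by move=> mA; rewrite fineK// fin_num_measure. Qed.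

Lemma prob_ge0 A : 0 <= prob A.
Proof. by rewrite fine_ge0. Qed.

Lemma prob0 : prob set0 = 0. Proof. by rewrite /prob measure0. Qed.

(** Total probability over the values of a finitely valued variable; all path
computations below are instances of it. *)
Lemma prob_sum (F : finType) (g : T -> F) (A : set T) :
  finite_rv g -> measurable A ->
  prob A = \sum_x prob (A `&` g @^-1` [set x]).
Proof.
move=> mg mA; apply: EFin_inj; rewrite -probE// -sumEFin.
transitivity (Pr (\bigcup_(x in [set: F]) (A `&` g @^-1` [set x]))).
  congr (Pr _); apply/seteqP; split=> [w Aw|w [x _ []]]//.
  by exists (g w).
rewrite measure_fin_bigcup//.
- rewrite (@fsbigE _ _ _ _ _ (index_enum F))//; last first.
  + by move=> x _; rewrite mem_index_enum.
  + exact: index_enum_uniq.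
  under eq_bigl do rewrite in_setT.
  apply: eq_bigr => x _.
  by rewrite -probE//; apply: measurableI.
- exact: finite_finset.
- by move=> x y _ _ [w [[_ /= <-] [_ /= <-]]].
- by move=> x _; exact: measurableI.
Qed.

Lemma le_prob A B : measurable A -> measurable B -> A `<=` B -> prob A <= prob B.
Proof.
by move=> mA mB AB; rewrite fine_le ?fin_num_measure//; apply: le_measure; rewrite ?inE.
Qed.

Section Paths.
Variables (S : finType) (M : nat -> T -> S).

Definition path_upto k (w : T) : {ffun 'I_k.+1 -> S} := [ffun i : 'I_k.+1 => M i w].

Hypothesis mM : forall k x, measurable (M k @^-1` [set x]).

Lemma finite_rv_path k : finite_rv (path_upto k).
Proof.
move=> f; have -> : path_upto k @^-1` [set f] =
    \bigcap_(i in [set: 'I_k.+1]) M i @^-1` [set f i].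
  apply/seteqP; split=> [w /= <- i _|w /= H]; first by rewrite /= ffunE.
  by apply/ffunP => i; rewrite ffunE; exact: H.
apply: fin_bigcap_measurable => // i _; exact: mM.
Qed.

Lemma cylinder_path (h : nat -> S) k :
  cylinder M h k = path_upto k @^-1` [set [ffun i : 'I_k.+1 => h i]].
Proof.
apply/seteqP; split=> [w /= H|w /= /ffunP H j jk].
  by apply/ffunP => i; rewrite !ffunE H// -ltnS.
have jk' : (j < k.+1)%N by [].
by have := H (Ordinal jk'); rewrite !ffunE.
Qed.

Lemma measurable_cylinder h k : measurable (cylinder M h k).
Proof. by rewrite cylinder_path; exact: finite_rv_path. Qed.

(** A path of finite length as a function on all times, so that it can be fed to
[cylinder]; y is the value taken at the later times. *)
Definition extend k (f : {ffun 'I_k.+1 -> S}) (y : S) (j : nat) : S :=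
  if (j <= k)%N then f (inord j) else y.

Lemma path_cylinder k (f : {ffun 'I_k.+1 -> S}) y :
  path_upto k @^-1` [set f] = cylinder M (extend f y) k.
Proof.
rewrite cylinder_path; congr (_ @^-1` [set _]); apply/ffunP => i.
by rewrite ffunE /extend -ltnS ltn_ord inord_val.
Qed.

Definition stays (C : pred S) k : set T := [set w | forall l, (l < k)%N -> C (M l w)].

Lemma stays_event C k :
  stays C k.+1 = [set w | [forall i, C (path_upto k w i)]].
Proof.
apply/seteqP; split=> [w H|w /= /forallP H l lk].
  by apply/forallP => i; rewrite ffunE H.
by have := H (Ordinal lk); rewrite ffunE.
Qed.

Lemma stays0 C : stays C 0 = setT.
Proof. by apply/seteqP; split. Qed.

Lemma staysS C k : stays C k.+1 = stays C k `&` [set w | C (M k w)].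
Proof.
apply/seteqP; split=> [w H|w /= [H Ck] l].
  by split=> [l lk|]; apply: H; rewrite ?(ltn_trans lk).
by rewrite ltnS leq_eqVlt => /orP[/eqP->|/H].
Qed.

Lemma measurable_stays C k : measurable (stays C k).
Proof.
case: k => [|k]; first by rewrite stays0.
rewrite stays_event.
apply: (finite_rv_event (fun f : {ffun 'I_k.+1 -> S} => [forall i, C (f i)])).
exact: finite_rv_path.
Qed.

End Paths.

Section Chain.
Variables (n : nat) (A : 'M[R]_n) (M : nat -> T -> option 'I_n) (D : set T).
Hypothesis mM : forall k x, measurable (M k @^-1` [set x]).
Hypothesis mD : measurable D.
Hypothesis HM : markov_given Pr D A M.

Lemma markov_path k (f : {ffun 'I_k.+1 -> option 'I_n}) y :
  prob (D `&` path_upto M k @^-1` [set f] `&` M k.+1 @^-1` [set y]) =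
  prob (D `&` path_upto M k @^-1` [set f]) * transition A (f ord_max) y.
Proof.
rewrite (path_cylinder _ f y).
have mC j : measurable (D `&` cylinder M (extend f y) j).
  by apply: measurableI => //; exact: measurable_cylinder.
have -> : D `&` cylinder M (extend f y) k `&` M k.+1 @^-1` [set y] =
          D `&` cylinder M (extend f y) k.+1.
  apply/seteqP; split=> [w /= [[Dw Cw] My]|w /= [Dw Cw]].
    split=> // j; rewrite leq_eqVlt => /orP[/eqP->|]; last exact: Cw.
    by rewrite /extend ltnn.
  split; first by split=> // j jk; apply: Cw; rewrite ltnW.
  by rewrite Cw// /extend ltnn.
apply: EFin_inj; rewrite EFinM -!probE// HM; congr (_ * (transition _ _ _)%:E)%E.
  by rewrite /extend leqnn; congr (f _); apply: val_inj; rewrite /= inordK.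
by rewrite /extend ltnn.
Qed.

(** The defining property of a chain concerns single paths up to time k.  Summing
it over the paths in B extends it to every event known at time k. *)
Lemma markov_step k (B : {ffun 'I_k.+1 -> option 'I_n} -> Prop) y :
  let E := D `&` [set w | B (path_upto M k w)] in
  prob (E `&` M k.+1 @^-1` [set y]) =
  \sum_x prob (E `&` M k @^-1` [set x]) * transition A x y.
Proof.
move=> E.
have mp : finite_rv (path_upto M k) by exact: finite_rv_path.
have mE : measurable E by apply: measurableI => //; exact: finite_rv_event.
rewrite (prob_sum mp); last exact: measurableI.
under [RHS]eq_bigr => x _.
  rewrite (prob_sum mp (measurableI _ _ mE (mM k x))) mulr_suml.
  over.
rewrite exchange_big; apply: eq_bigr => f _ /=.
rewrite (bigD1 (f ord_max))//= [X in _ + X]big1 ?addr0; last first.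
  move=> x xf; rewrite (_ : _ `&` _ = set0) ?prob0 ?mul0r//.
  apply/seteqP; split=> // w /= [[_ Mx] pf].
  by move: xf; rewrite -pf ffunE Mx eqxx.
have [Bf|nBf] := pselect (B f); last first.
  rewrite (_ : _ `&` _ = set0); last first.
    by apply/seteqP; split=> // w /= [[[_ Bw] _] pf]; apply: nBf; rewrite -pf.
  rewrite (_ : _ `&` _ = set0) ?prob0 ?mul0r//.
  by apply/seteqP; split=> // w /= [[[_ Bw] _] pf]; apply: nBf; rewrite -pf.
rewrite [X in X * _](_ : _ = prob (D `&` path_upto M k @^-1` [set f])).
  rewrite -markov_path; congr prob; apply/seteqP.
  split=> [w /= [[[Dw _] My] pf]|w /= [[Dw pf] My]]//.
  by split=> //; split=> //; split=> //=; rewrite pf.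
congr prob; apply/seteqP; split=> [w /= [[[Dw _] My] pf]|w /= [Dw pf]]//.
split=> //=; split; last by rewrite -pf ffunE.
by split=> //=; rewrite pf.
Qed.

(** Taboo probability: on the event D, the chain stays in C strictly before time k
and is in y at time k.  Both the exit from E and the absorption in None are
first passages, hence values of such probabilities outside C. *)
Definition taboo (C : pred (option 'I_n)) k (y : option 'I_n) : R :=
  prob (D `&` stays M C k `&` M k @^-1` [set y]).

Lemma taboo0 C y : taboo C 0 y = prob (D `&` M 0%N @^-1` [set y]).
Proof. by rewrite /taboo stays0 setIT. Qed.

Lemma tabooS C k y :
  taboo C k.+1 y = \sum_(x | C x) taboo C k x * transition A x y.
Proof.
rewrite /taboo stays_event (markov_step (fun f => [forall i, C (f i)])).
rewrite [RHS]big_mkcond; apply: eq_bigr => x _.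
rewrite -stays_event staysS; case: ifPn => Cx.
  congr (prob _ * _); apply/seteqP; split=> [w /= [[Dw [Sw _]] Mx]|w /= [[Dw Sw] Mx]]//.
  by split=> //; split=> //; split=> //=; rewrite Mx.
rewrite (_ : _ `&` _ = set0) ?prob0 ?mul0r//.
apply/seteqP; split=> // w /= [[_ [_ Cw]] Mx].
by move: Cx; rewrite -Mx Cw.
Qed.

End Chain.
End FiniteValued.

(** * First passage and absorption *)

Section HittingTime.
Context {R : realType} {X : Type} (A : set X) (x : nat -> X).

(** The infimum over an empty set is infinite, so that a chain that is never
absorbed causes no exception here. *)
Lemma le_hitting_time n : (n%:R%:E <= hitting_time (R := R) A x)%E <->
  forall l, (0 < l < n)%N -> ~ A (x l).
Proof.
split=> [H l /andP[l0 ln] Al|H].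
  have : (hitting_time (R := R) A x <= l%:R%:E)%E.
    by apply: ereal_inf_lbound; exists l.
  by move/(le_trans H); rewrite lee_fin ler_nat leqNgt ln.
apply: le_ereal_inf_tmp => _ [l [l1 Al] <-]; rewrite lee_fin ler_nat leqNgt.
by apply/negP => ln; apply: (H l) => //; rewrite l1.
Qed.

Lemma hitting_timeE n : hitting_time A x = n%:R%:E :> \bar R <->
  [/\ (0 < n)%N, A (x n) & forall l, (0 < l < n)%N -> ~ A (x l)].
Proof.
split=> [E|[n0 An H]]; last first.
  apply/eqP; rewrite eq_le; apply/andP; split; last exact/le_hitting_time.
  by apply: ereal_inf_lbound; exists n.
have H : forall l, (0 < l < n)%N -> ~ A (x l) by apply/le_hitting_time; rewrite E.
suff : (0 < n)%N /\ A (x n) by case.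
apply: contrapT => nA.
suff : (n.+1%:R%:E <= hitting_time (R := R) A x)%E.
  by rewrite E lee_fin ler_nat ltnn.
apply/le_hitting_time => l /andP[l0]; rewrite ltnS leq_eqVlt => /orP[/eqP e|ln] Al.
  by apply: nA; rewrite -e.
by apply: (H l) => //; rewrite l0.
Qed.

End HittingTime.

Lemma big_option (R : Type) (idx : R) (op : Monoid.com_law idx) (I : finType)
    (P : pred (option I)) (F : option I -> R) :
  \big[op/idx]_(x | P x) F x =
  op (if P None then F None else idx) (\big[op/idx]_(i | P (Some i)) F (Some i)).
Proof.
rewrite big_mkcond (bigD1 None)//=; congr (op _ _).
rewrite -big_mkcondr (reindex_omap Some id); last by case.
by apply: eq_bigl => i /=; rewrite eqxx andbT.
Qed.

(** Boolean form of membership in E, needed as the set of allowed states of a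
taboo probability. *)
Definition in_Eb p q (x : option 'I_(p + q)) : bool :=
  if x is Some i then (i < p)%N else false.
Arguments in_Eb : clear implicits.

Section BlockChains.
Context {R : realType} {d : measure_display} {T : measurableType d}.
Variable Pr : probability T R.

(** The probabilities of terminating at the next step. *)
Definition exit_col n (Q : 'M[R]_n) : 'cV[R]_n := \col_i (1 - \sum_j Q i j).

(** The discrete phase-type law: the probability that a chain with matrix Q
started in i terminates exactly at time k. *)
Definition phase_type_law n (Q : 'M[R]_n) (i : 'I_n) (k : nat) : R :=
  if k is k'.+1 then (Q ^+ k' *m exit_col Q) i 0 else 0.

Local Arguments transition : simpl never.

Section Transition.
Variables (p q : nat) (A : 'M[R]_p) (B : 'M[R]_(p, q)) (Q : 'M[R]_q).
Let K := block_mx A B 0 Q.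

Lemma transition_ll i j : transition K (Some (lshift q i)) (Some (lshift q j)) = A i j.
Proof. by rewrite /transition block_mxEul. Qed.
Lemma transition_lr i j : transition K (Some (lshift q i)) (Some (rshift p j)) = B i j.
Proof. by rewrite /transition block_mxEur. Qed.
Lemma transition_rl i j : transition K (Some (rshift p i)) (Some (lshift q j)) = 0.
Proof. by rewrite /transition block_mxEdl mxE. Qed.
Lemma transition_rr i j : transition K (Some (rshift p i)) (Some (rshift p j)) = Q i j.
Proof. by rewrite /transition block_mxEdr. Qed.
Lemma transition_lN i : transition K (Some (lshift q i)) None =
  1 - (\sum_j A i j + \sum_j B i j).
Proof.
rewrite /transition big_split_ord /=; congr (1 - (_ + _)); apply: eq_bigr => j _.
  by rewrite block_mxEul.
by rewrite block_mxEur.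
Qed.
Lemma transition_rN i : transition K (Some (rshift p i)) None = exit_col Q i 0.
Proof.
rewrite /transition big_split_ord /= mxE big1 ?add0r; last first.
  by move=> j _; rewrite block_mxEdl mxE.
by congr (1 - _); apply: eq_bigr => j _; rewrite block_mxEdr.
Qed.

End Transition.

Section Absorption.
Variables (p q : nat) (A : 'M[R]_p) (B : 'M[R]_(p, q)) (Q : 'M[R]_q).
Variables (N : nat -> T -> option 'I_(p + q)) (D : set T) (i : 'I_q).
Hypothesis mN : forall k x, measurable (N k @^-1` [set x]).
Hypothesis mD : measurable D.
Hypothesis HN : markov_given Pr D (block_mx A B 0 Q) N.
Hypothesis DN : forall w, D w -> N 0%N w = Some (rshift p i).

(** A state of S never leads back to E, so only the block Q matters for a chain
started in S. *)
Lemma taboo_phase k :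
  (forall j, taboo Pr N D isSome k (Some (lshift q j)) = 0) /\
  (forall j, taboo Pr N D isSome k (Some (rshift p j)) = prob Pr D * (Q ^+ k) i j).
Proof.
elim: k => [|k [IHl IHr]].
  split=> j; rewrite taboo0.
    rewrite (_ : _ `&` _ = set0) ?prob0//; apply/seteqP; split=> // w /= [/DN ->].
    by move=> /Some_inj /eqP; rewrite eq_rlshift.
  rewrite expr0 mxE; have [<-|ij] := eqVneq i j.
    rewrite mulr1; congr (prob _ _).
    by apply/seteqP; split=> [w []//|w Dw]; split=> //; exact: DN.
  rewrite mulr0 (_ : _ `&` _ = set0) ?prob0//; apply/seteqP; split=> // w /= [/DN ->].
  by move=> /Some_inj /eqP; rewrite eq_rshift (negPf ij).
split=> j; rewrite (tabooS mN mD HN) big_option /= add0r big_split_ord /=.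
  rewrite big1 ?add0r; last by move=> l _; rewrite IHl mul0r.
  by rewrite big1// => l _; rewrite transition_rl mulr0.
rewrite big1 ?add0r; last by move=> l _; rewrite IHl mul0r.
rewrite exprSr -[Q ^+ k * Q]/(Q ^+ k *m Q) mxE mulr_sumr.
by apply: eq_bigr => l _; rewrite IHr transition_rr mulrA.
Qed.

Lemma taboo_absorption k :
  taboo Pr N D isSome k None = prob Pr D * phase_type_law Q i k.
Proof.
case: k => [|k] /=.
  rewrite taboo0 mulr0 (_ : _ `&` _ = set0) ?prob0//.
  by apply/seteqP; split=> // w /= [/DN ->].
have [IHl IHr] := taboo_phase k.
rewrite (tabooS mN mD HN) big_option /= add0r big_split_ord /=.
rewrite big1 ?add0r; last by move=> l _; rewrite IHl mul0r.
rewrite mxE mulr_sumr; apply: eq_bigr => l _.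
by rewrite IHr transition_rN mulrA.
Qed.

End Absorption.

Lemma in_EP p q x : in_E x <-> in_Eb p q x.
Proof.
split=> [[i ->]/=|]; first exact: (ltn_ord i).
case: x => //= i ip; exists (Ordinal ip); congr Some; exact: val_inj.
Qed.

Section Exit.
Variables (p q : nat) (alpha : 'rV[R]_p) (A : 'M[R]_p) (B : 'M[R]_(p, q)) (Q : 'M[R]_q).
Variable M : nat -> T -> option 'I_(p + q).
Hypothesis mM : forall k x, measurable (M k @^-1` [set x]).
Hypothesis AB1 : forall i, \sum_j A i j + \sum_j B i j = 1.
Hypothesis alpha1 : \sum_i alpha 0 i = 1.
Hypothesis M0 : forall i, Pr (M 0%N @^-1` [set Some i]) =
  ((row_mx alpha (0 : 'rV[R]_q)) 0 i)%:E.
Hypothesis HM : markov_given Pr setT (block_mx A B 0 Q) M.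

Let g := taboo Pr M setT (in_Eb p q).

Lemma prob_initial i : prob Pr (M 0%N @^-1` [set Some i]) = row_mx alpha (0 : 'rV[R]_q) 0 i.
Proof. by rewrite /prob M0. Qed.

Let g0r j : g 0 (Some (rshift p j)) = 0.
Proof. by rewrite /g taboo0 setTI prob_initial row_mxEr mxE. Qed.

Let g0N : g 0 None = 0.
Proof.
rewrite /g taboo0 setTI.
have := @prob_sum _ _ _ Pr _ (M 0) setT (mM 0%N) measurableT.
rewrite {1}/prob probability_setT big_option /= setTI => /eqP.
under eq_bigr do rewrite setTI prob_initial.
rewrite big_split_ord /=; under eq_bigr do rewrite row_mxEl.
rewrite alpha1; under eq_bigr do rewrite row_mxEr mxE.
rewrite big1_eq addr0 -subr_eq subrr => /eqP <- //.
Qed.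

(** The exit law of E.  The rows of (P U) sum to one and the initial vector is
carried by E, so the chain can leave E only into S: neither a start in S nor a
direct passage to None has positive probability. *)
Lemma taboo_exit k :
  [/\ forall j, g k (Some (lshift q j)) = (alpha *m A ^+ k) 0 j,
      forall j, g k.+1 (Some (rshift p j)) = (alpha *m A ^+ k *m B) 0 j,
      forall j, g 0 (Some (rshift p j)) = 0 &
      g k None = 0].
Proof.
have step m y : g m.+1 y =
    \sum_i g m (Some (lshift q i)) * transition (block_mx A B 0 Q) (Some (lshift q i)) y.
  rewrite /g (tabooS mM measurableT HM) big_option /= add0r big_mkcond big_split_ord /=.
  rewrite [X in _ + X]big1 ?addr0; last by move=> i _; rewrite ltnNge leq_addr.
  by apply: eq_bigr => i _; rewrite ltn_ord.
have gl : forall j, g k (Some (lshift q j)) = (alpha *m A ^+ k) 0 j.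
  elim: k => [|k IH] j.
    by rewrite /g taboo0 setTI prob_initial row_mxEl expr0 mulmx1.
  rewrite step exprSr -[A ^+ k * A]/(A ^+ k *m A) mulmxA mxE.
  by apply: eq_bigr => i _; rewrite IH transition_ll.
split => // [j|].
  by rewrite step [RHS]mxE; apply: eq_bigr => i _; rewrite gl transition_lr.
case: k {gl} => // k.
by rewrite step big1// => i _; rewrite transition_lN AB1 subrr mulr0.
Qed.

End Exit.

(** A path up to time t followed by a path from time t on is a path from time 0,
provided that they agree at time t; if they do not, both sides vanish. *)
Lemma markov_given_shift n (A : 'M[R]_n) (M : nat -> T -> option 'I_n) t h :
  markov_given Pr setT A M ->
  markov_given Pr (cylinder M h t) A (fun j => M (t + j)%N).
Proof.
move=> HM f k.
have [ft|ft] := eqVneq (f 0%N) (h t); last first.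
  suff E j : cylinder M h t `&` cylinder (fun j => M (t + j)%N) f j = set0.
    by rewrite !E measure0 mul0e.
  apply/seteqP; split=> // w [/= Hw Fw]; move: ft.
  by rewrite -(Fw 0%N)// addn0 Hw// eqxx.
(* The concatenation of h and f. *)
pose u j := if (j <= t)%N then h j else f (j - t)%N.
have ut j : u (t + j)%N = f j.
  rewrite /u; case: j => [|j]; first by rewrite addn0 leqnn ft.
  by rewrite leqNgt -[X in (X < _)%N]addn0 ltn_add2l /= addKn.
suff E j : cylinder M h t `&` cylinder (fun j => M (t + j)%N) f j = setT `&` cylinder M u (t + j).
  by rewrite !E addnS HM -addnS !ut.
rewrite setTI; apply/seteqP; split=> [w [Hw Fw] l lj|w H].
  rewrite /u; case: leqP => lt; first exact: Hw.
  by rewrite -(Fw (l - t)%N) ?subnKC ?leq_subLR// ltnW.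
split=> l lj; first by rewrite H ?(leq_trans lj) ?leq_addr// /u lj.
by rewrite H ?leq_add2l// ut.
Qed.

(** Conditional independence on cylinders, summed over the paths in B1 and in B2.
Multiplying by the probability of D replaces a division by it. *)
Lemma prob_cond_indep n (D : set T) (N1 N2 : nat -> T -> option 'I_n) k l
    (B1 : {ffun 'I_k.+1 -> option 'I_n} -> Prop)
    (B2 : {ffun 'I_l.+1 -> option 'I_n} -> Prop) :
  measurable D ->
  (forall k x, measurable (N1 k @^-1` [set x])) ->
  (forall k x, measurable (N2 k @^-1` [set x])) ->
  (forall f g k l,
    (Pr (D `&` (cylinder N1 f k `&` cylinder N2 g l)) * Pr D =
     Pr (D `&` cylinder N1 f k) * Pr (D `&` cylinder N2 g l))%E) ->
  let E1 := [set w | B1 (path_upto N1 k w)] in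
  let E2 := [set w | B2 (path_upto N2 l w)] in
  prob Pr (D `&` (E1 `&` E2)) * prob Pr D =
  prob Pr (D `&` E1) * prob Pr (D `&` E2).
Proof.
move=> mD m1 m2 H E1 E2.
have mp1 : finite_rv (path_upto N1 k) by exact: finite_rv_path.
have mp2 : finite_rv (path_upto N2 l) by exact: finite_rv_path.
have mE1 : measurable E1 by exact: finite_rv_event.
have mE2 : measurable E2 by exact: finite_rv_event.
have mDE : measurable (D `&` (E1 `&` E2)) by apply: measurableI => //; exact: measurableI.
rewrite (prob_sum Pr mp1 mDE) (prob_sum Pr mp1 (measurableI _ _ mD mE1)).
rewrite !mulr_suml; apply: eq_bigr => f _.
rewrite (prob_sum Pr mp2 (measurableI _ _ mDE (mp1 f))).
rewrite (prob_sum Pr mp2 (measurableI _ _ mD mE2)).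
rewrite mulr_suml mulr_sumr; apply: eq_bigr => g _.
have [Bf|nBf] := pselect (B1 f); last first.
  rewrite (_ : D `&` E1 `&` _ = set0) ?prob0 ?mul0r; last first.
    by apply/seteqP; split=> // w /= [[_ Ew] pf]; apply: nBf; rewrite -pf.
  rewrite (_ : _ `&` _ = set0) ?prob0 ?mul0r//.
  by apply/seteqP; split=> // w /= [[[_ [Ew _]] pf] _]; apply: nBf; rewrite -pf.
have [Bg|nBg] := pselect (B2 g); last first.
  rewrite [D `&` E2 `&` _](_ : _ = set0) ?prob0 ?mulr0; last first.
    by apply/seteqP; split=> // w /= [[_ Ew] pf]; apply: nBg; rewrite -pf.
  rewrite (_ : _ `&` _ = set0) ?prob0 ?mul0r//.
  by apply/seteqP; split=> // w /= [[[_ [_ Ew]] _] pf]; apply: nBg; rewrite -pf.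
pose C1 := cylinder N1 (extend f (f ord0)) k.
pose C2 := cylinder N2 (extend g (g ord0)) l.
have e1 : path_upto N1 k @^-1` [set f] = C1 by exact: path_cylinder.
have e2 : path_upto N2 l @^-1` [set g] = C2 by exact: path_cylinder.
rewrite (_ : D `&` E1 `&` _ = D `&` C1); last first.
  rewrite -e1; apply/seteqP; split=> [w /= [[Dw _] pf]|w /= [Dw pf]]//.
  by split=> //; split=> //; rewrite /E1 /= pf.
rewrite [D `&` E2 `&` _](_ : _ = D `&` C2); last first.
  rewrite -e2; apply/seteqP; split=> [w /= [[Dw _] pf]|w /= [Dw pf]]//.
  by split=> //; split=> //; rewrite /E2 /= pf.
rewrite (_ : _ `&` _ = D `&` (C1 `&` C2)); last first.
  rewrite -e1 -e2; apply/seteqP; split=> [w /= [[[Dw _] pf] pg]|w /= [Dw [pf pg]]]//.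
  by split=> //; split=> //; split=> //; rewrite /E1 /E2; split; rewrite /= ?pf ?pg.
have mC1 : measurable C1 by exact: measurable_cylinder.
have mC2 : measurable C2 by exact: measurable_cylinder.
have mC : measurable (D `&` (C1 `&` C2)) by apply: measurableI => //; exact: measurableI.
have mD1 : measurable (D `&` C1) by exact: measurableI.
have mD2 : measurable (D `&` C2) by exact: measurableI.
by apply: EFin_inj; rewrite !EFinM -!probE ?H.
Qed.

End BlockChains.

(** * Joint law of the termination times *)

Section Termination.
Context {R : realType} {d : measure_display} {T : measurableType d}.

Definition first_none n (N : nat -> T -> option 'I_n) k : set T :=
  stays N isSome k `&` N k @^-1` [set None].

(** Exhibits the first passage to None as an event of the path up to time k, the
form in which [prob_cond_indep] applies to it. *)
Lemma first_none_event n (N : nat -> T -> option 'I_n) k :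
  first_none N k = [set w |
    [forall l : 'I_k, isSome (path_upto N k w (widen_ord (leqnSn k) l))]
    /\ path_upto N k w ord_max = None].
Proof.
apply/seteqP; split=> [w /= [Sw Nw]|w /= [/forallP Sw]].
  split; last by rewrite ffunE.
  by apply/forallP => l; rewrite ffunE; exact: (Sw _ (ltn_ord l)).
rewrite ffunE => Nw; split=> // l lk.
by have := Sw (Ordinal lk); rewrite ffunE.
Qed.

Lemma measurable_first_none n (N : nat -> T -> option 'I_n) k :
  (forall k x, measurable (N k @^-1` [set x])) -> measurable (first_none N k).
Proof. by move=> mN; apply: measurableI; [exact: measurable_stays|exact: mN]. Qed.

(** Truncated subtraction covers all cases: for m <= t both sides fail, because
the chain is not absorbed at time t. *)
Lemma termination_time_shift n (M : nat -> T -> option 'I_n) w t m :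
  (forall l, (l <= t)%N -> M l w <> None) ->
  (termination_time M w = m%:R%:E :> \bar R) <->
  first_none (fun j => M (t + j)%N) (m - t)%N w.
Proof.
move=> Ht; split=> [/hitting_timeE[m0 Mm H]|[Sw /= Nw]].
  have tm : (t < m)%N by rewrite ltnNge; apply/negP => /Ht.
  split; last by rewrite /= subnKC// ltnW.
  move=> l lm; have [lt0|lt0] := posnP (t + l)%N.
    by rewrite lt0; have := Ht 0%N isT; case: (M 0%N w).
  have /H : (0 < t + l < m)%N by rewrite lt0 -ltn_subRL.
  by rewrite /=; case: (M (t + l)%N w).
have tm : (t < m)%N.
  rewrite ltnNge -subn_eq0; apply/negP => /eqP mt.
  by move: Nw; rewrite mt addn0; apply: Ht.
apply/hitting_timeE; rewrite subnKC in Nw; last exact: ltnW.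
split=> //; first exact: leq_trans tm.
move=> l /andP[l0 lm] /= Ml; have [lt|tl] := leqP l t; first exact: Ht lt Ml.
have := Sw (l - t)%N; rewrite ltn_sub2r// subnKC ?Ml; last exact: ltnW.
by move=> /(_ isT).
Qed.

Lemma measurable_termination_time n (M : nat -> T -> option 'I_n) m :
  (forall k x, measurable (M k @^-1` [set x])) ->
  measurable [set w | termination_time M w = m%:R%:E :> \bar R].
Proof.
move=> mM.
have -> : [set w | termination_time M w = m%:R%:E :> \bar R] =
  [set w | [/\ (0 < m)%N, path_upto M m w ord_max = None &
    forall l : 'I_m.+1, (0 < l < m)%N -> path_upto M m w l <> None]].
  apply/seteqP; split=> [w /= /hitting_timeE[m0 Mm H]|w /= [m0]].
    by split=> // [|l lm]; rewrite ffunE//; exact: H.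
  rewrite ffunE => Mm H; apply/hitting_timeE; split=> // l lm.
  have lm' : (l < m.+1)%N by case/andP: lm => _ /ltnW.
  by have := H (Ordinal lm') lm; rewrite ffunE.
have mp : finite_rv (path_upto M m) by exact: finite_rv_path.
exact: (finite_rv_event (fun f : {ffun 'I_m.+1 -> option 'I_n} =>
  [/\ (0 < m)%N, f ord_max = None & forall l : 'I_m.+1, (0 < l < m)%N -> f l <> None]) mp).
Qed.

End Termination.

(** The probability of entering S at time t in state i. *)
Definition exit_law {R : realType} p q (alpha : 'rV[R]_p) (P : 'M[R]_p) (U : 'M[R]_(p, q))
    (i : 'I_q) (t : nat) : R :=
  if t is t'.+1 then (alpha *m P ^+ t' *m U) 0 i else 0.

Section JointLaw.
Context {R : realType} {d : measure_display} {T : measurableType d}.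
Variable Pr : probability T R.
Variables (p q : nat) (alpha : 'rV[R]_p) (P : 'M[R]_p) (U : 'M[R]_(p, q)).
Variables (Q1 Q2 : 'M[R]_q) (M1 M2 : nat -> T -> option 'I_(p + q)).
Hypothesis alpha1 : \sum_i alpha 0 i = 1.
Hypothesis PU1 : forall i, \sum_j P i j + \sum_j U i j = 1.
Hypothesis HM : cdph_chains Pr alpha P U Q1 Q2 M1 M2.

Let mM1 k x : measurable (M1 k @^-1` [set x]).
Proof. by case: HM => /(_ k x)[]. Qed.

Let mM2 k x : measurable (M2 k @^-1` [set x]).
Proof. by case: HM => /(_ k x)[]. Qed.

Let Ev m n := [set w | termination_time M1 w = m%:R%:E :> \bar R /\
                       termination_time M2 w = n%:R%:E :> \bar R].

Let mEv m n : measurable (Ev m n).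
Proof.
rewrite (_ : Ev m n = [set w | termination_time M1 w = m%:R%:E :> \bar R] `&`
  [set w | termination_time M2 w = n%:R%:E :> \bar R])//.
by apply: measurableI; exact: measurable_termination_time.
Qed.

(** On a path h that leaves E at time t into state i, the two chains agree up to
time t, and from then on each is a chain started in i.  Both termination times
are then first passages of the shifted chains, which are independent given h.
A path of probability zero is treated apart, as nothing can be divided by it. *)
Lemma prob_termination_cylinder t (h : nat -> option 'I_(p + q)) i m n :
  (0 < t)%N -> (forall l, (l < t)%N -> in_Eb p q (h l)) ->
  h t = Some (rshift p i) ->
  prob Pr (cylinder M1 h t `&` Ev m n) =
  prob Pr (cylinder M1 h t) *
    (phase_type_law Q1 i (m - t) * phase_type_law Q2 i (n - t)).
Proof.
move=> t0 hl ht; set D := cylinder M1 h t.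
pose N1 j := M1 (t + j)%N; pose N2 j := M2 (t + j)%N.
have mD : measurable D by exact: measurable_cylinder.
have mN1 k x : measurable (N1 k @^-1` [set x]) by exact: mM1.
have mN2 k x : measurable (N2 k @^-1` [set x]) by exact: mM2.
have Dexit w : D w -> exit_E M1 w = t%:R%:E :> \bar R.
  move=> Dw; apply/hitting_timeE; split=> //.
    by rewrite /= in_EP Dw// ht /= ltnNge leq_addr.
  move=> l /andP[_ lt]; rewrite /= in_EP Dw 1?ltnW//.
  by move=> H; apply: H; exact: hl.
have D2 w l : D w -> (l <= t)%N -> M2 l w = M1 l w.
  move=> Dw lt; case: HM => _ _ _ + _; apply.
  by rewrite Dexit// lee_fin ler_nat.
have D1 w l : D w -> (l <= t)%N -> M1 l w <> None.
  move=> Dw lt; rewrite Dw//; move: lt; rewrite leq_eqVlt => /orP[/eqP->|/hl].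
    by rewrite ht.
  by case: (h l).
have Mk1 : markov_given Pr D (block_mx P U 0 Q1) N1.
  by apply: markov_given_shift; case: HM.
have eD : [set w | exit_E M1 w = t%:R%:E :> \bar R] `&` cylinder M1 h t = D.
  by apply/seteqP; split=> [w []//|w Dw]; split=> //=; exact: Dexit.
have [Mk2 ind] : markov_given Pr D (block_mx 0 0 0 Q2) N2 /\
    forall f g k l,
    (Pr (D `&` (cylinder N1 f k `&` cylinder N2 g l)) * Pr D =
     Pr (D `&` cylinder N1 f k) * Pr (D `&` cylinder N2 g l))%E.
  by case: HM => _ _ _ _ /(_ t h) /=; rewrite eD.
have DN1 w : D w -> N1 0%N w = Some (rshift p i).
  by move=> Dw; rewrite /N1 addn0 Dw.
have DN2 w : D w -> N2 0%N w = Some (rshift p i).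
  by move=> Dw; rewrite /N2 addn0 D2// Dw.
have p1 := taboo_absorption mN1 mD Mk1 DN1 (m - t).
have p2 := taboo_absorption mN2 mD Mk2 DN2 (n - t).
have -> : D `&` Ev m n = D `&` (first_none N1 (m - t) `&` first_none N2 (n - t)).
  apply/seteqP; split=> [w [Dw [E1 E2]]|w [Dw [E1 E2]]]; split=> //; split.
  - by apply/(termination_time_shift (R := R)) => // l; exact: D1.
  - by apply/(termination_time_shift (R := R)) => // l lt; rewrite D2//; exact: D1.
  - by apply/(termination_time_shift (R := R) (t := t)) => // l; exact: D1.
  - by apply/(termination_time_shift (R := R) (t := t)) => // l lt; rewrite D2//; exact: D1.
have := prob_cond_indep
  (fun f : {ffun 'I_(m - t).+1 -> option 'I_(p + q)} =>
    [forall l : 'I_(m - t), isSome (f (widen_ord (leqnSn _) l))] /\ f ord_max = None)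
  (fun f : {ffun 'I_(n - t).+1 -> option 'I_(p + q)} =>
    [forall l : 'I_(n - t), isSome (f (widen_ord (leqnSn _) l))] /\ f ord_max = None)
  mD mN1 mN2 ind.
rewrite /= -!first_none_event.
rewrite /taboo -!setIA in p1 p2.
rewrite [in RHS]/first_none {}p1 {}p2 => E.
(* Conditional independence gives the claim multiplied by the probability of
   the path, which has to be cancelled. *)
have [D0|D0] := eqVneq (prob Pr D) 0.
  rewrite D0 mul0r; apply/eqP; rewrite eq_le prob_ge0 andbT -D0.
  apply: le_prob => [||w []]//.
  by apply: measurableI => //; apply: measurableI; exact: measurable_first_none.
by apply: (mulIf D0); rewrite E mulrACA [RHS]mulrAC mulrA.
Qed.

Let g := taboo Pr M1 setT (in_Eb p q).

Let M1_initial i : Pr (M1 0%N @^-1` [set Some i]) =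
  ((row_mx alpha (0 : 'rV[R]_q)) 0 i)%:E.
Proof. by case: HM. Qed.

Let M1_markov : markov_given Pr setT (block_mx P U 0 Q1) M1.
Proof. by case: HM. Qed.

Let taboo_exit1 := taboo_exit mM1 PU1 alpha1 M1_initial M1_markov.

(** Sum of the preceding identity over the paths that stay in E before time t and
are in state i of S at time t. *)
Lemma prob_termination_exit t i m n :
  prob Pr (stays M1 (in_Eb p q) t `&` M1 t @^-1` [set Some (rshift p i)] `&` Ev m n) =
  exit_law alpha P U i t * (phase_type_law Q1 i (m - t) * phase_type_law Q2 i (n - t)).
Proof.
set B := _ `&` M1 t @^-1` _.
have mB : measurable B by apply: measurableI => //; exact: measurable_stays.
have gB : prob Pr B = exit_law alpha P U i t.
  rewrite (_ : prob _ _ = g t (Some (rshift p i))); last by rewrite /g /taboo setTI.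
  case: t {B mB} => [|t] /=; first by case: (taboo_exit1 0).
  by case: (taboo_exit1 t).
have [t0|t0] := posnP t.
  have B0 : prob Pr B = 0 by rewrite gB t0.
  rewrite -gB B0 mul0r; apply/eqP; rewrite eq_le prob_ge0 andbT -B0.
  apply: le_prob => [||w []]//; exact: measurableI.
rewrite -gB; have mp : finite_rv (path_upto M1 t) by exact: finite_rv_path.
rewrite (prob_sum Pr mp); last exact: measurableI.
rewrite [in RHS](prob_sum Pr mp)// mulr_suml; apply: eq_bigr => f _.
have [[Sf ft]|nf] := pselect ((forall l : 'I_t.+1, (l < t)%N -> in_Eb p q (f l)) /\
    f ord_max = Some (rshift p i)); last first.
  suff B0 : B `&` path_upto M1 t @^-1` [set f] = set0.
    by rewrite setIAC B0 set0I prob0 mul0r.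
  apply/seteqP; split=> // w /= [[Sw Mw] pf]; apply: nf; split=> [l lt|].
    by rewrite -pf ffunE; exact: Sw.
  by rewrite -pf ffunE.
have hf l (lt : (l <= t)%N) : extend f (f ord0) l = f (Ordinal (lt : (l < t.+1)%N)).
  by rewrite /extend lt; congr (f _); apply: val_inj; rewrite /= inordK.
have Bf : B `&` path_upto M1 t @^-1` [set f] = cylinder M1 (extend f (f ord0)) t.
  rewrite -path_cylinder; apply/seteqP; split=> [w []//|w /= pf]; split=> //.
  split=> [l lt|/=].
    have lt' : (l < t.+1)%N by exact: ltnW.
    by have := Sf (Ordinal lt') lt; rewrite -pf ffunE.
  by rewrite -ft -pf ffunE.
rewrite setIAC Bf (@prob_termination_cylinder t _ i)//.
  by move=> l lt; rewrite (hf _ (ltnW lt)); exact: Sf.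
by rewrite (hf _ (leqnn t)) -ft; congr (f _); exact: val_inj.
Qed.

(** If tau1 = m is finite then M1 does leave E, at a first time t.  The pieces of
this countable partition on which M1 is absorbed directly at time t are null,
and the truncated differences vanish for t >= min(m, n). *)
Lemma joint_law m n :
  Pr (Ev m n) = (\sum_(0 <= t <oo) (\sum_i exit_law alpha P U i t *
    (phase_type_law Q1 i (m - t) * phase_type_law Q2 i (n - t)))%:E)%E.
Proof.
pose X t := stays M1 (in_Eb p q) t `&` [set w | ~ in_Eb p q (M1 t w)].
have mX t : measurable (X t).
  apply: measurableI; first exact: measurable_stays.
  exact: (finite_rv_event (fun x => ~ in_Eb p q x) (mM1 t)).
transitivity (Pr (\bigcup_(t in setT) (X t `&` Ev m n))).
  congr (Pr _); apply/seteqP; split=> [w Ew|w [t _ []]//].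
  have ex : exists t, ~~ in_Eb p q (M1 t w).
    by exists m; case: Ew => /hitting_timeE[_ -> _].
  exists (ex_minn ex) => //; split=> //.
  case: ex_minnP => t /negP nt H; split=> // l lt.
  by apply: contraLR lt => /H; rewrite -leqNgt.
rewrite measure_bigcup//; last 2 first.
- by move=> t _; exact: measurableI.
- apply/trivIsetP => s t _ _ st.
  wlog lt : s t st / (s < t)%N.
    move=> H; move: (st); rewrite neq_ltn => /orP[/H->//|lt].
    by rewrite setIC H// eq_sym.
  apply/seteqP; split=> // w [[[_ Xs] _] [[Xt _] _]].
  by apply: Xs; exact: Xt.
rewrite (eq_eseriesl (Q := xpredT)); last by move=> t; rewrite in_setT.
apply: eq_eseriesr => t _.
transitivity ((prob Pr (X t `&` Ev m n))%:E).
  by apply: probE; exact: measurableI.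
congr (_ %:E); rewrite (prob_sum Pr (mM1 t)); last exact: measurableI.
(* Values of the state at time t: None is null, the states of E contradict the
   exit, and those of S give the terms of the sum. *)
rewrite big_option /= [X in X + _](_ : _ = 0) ?add0r; last first.
  apply/eqP; rewrite eq_le prob_ge0 andbT.
  have [_ _ _ <-] := taboo_exit1 t.
  apply: le_prob => //.
  - by apply: measurableI => //; exact: measurableI.
  - by apply: measurableI => //; apply: measurableI => //; exact: measurable_stays.
  - by move=> w [[[Sw _] _] Mw]; split=> //; split.
rewrite big_split_ord /= big1 ?add0r; last first.
  move=> i _; rewrite (_ : _ `&` _ = set0) ?prob0//.
  apply/seteqP; split=> // w [[[_ /= Xw] _] /= Mw].
  by apply: Xw; rewrite Mw /= ltn_ord.
apply: eq_bigr => i _; rewrite -prob_termination_exit; congr (prob _ _).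
apply/seteqP; split=> [w [[[Sw Xw] Ew] Mw]|w [[Sw Mw] Ew]].
  by split.
split=> //; split=> //; split=> //=.
by rewrite Mw /= ltnNge leq_addr.
Qed.

End JointLaw.

(** * Expectations of products of independent variables *)

Section IndependentProducts.
Context {R : realType} {d dX : measure_display}.
Context {T : measurableType d} {X : measurableType dX}.
Variable Pr : probability T R.

Import HBNNSimple.

(** The hypothesis says that the law of V under the measure with density g is c
times its law under Pr.  The conclusion extends this from indicators to simple
functions by linearity, and to f by monotone convergence. *)
Lemma integral_weighted (V : T -> X) (g : T -> R) (f : X -> R) (c : R) :
  measurable_fun setT V -> measurable_fun setT g -> (forall w, 0 <= g w) ->
  0 <= c ->
  (forall B, measurable B ->
    (\int[Pr]_w (g w * \1_B (V w))%:E = c%:E * Pr (V @^-1` B))%E) ->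
  measurable_fun setT f -> (forall x, 0 <= f x) ->
  (\int[Pr]_w (g w * f (V w))%:E = c%:E * \int[Pr]_w (f (V w))%:E)%E.
Proof.
move=> mV mg g0 c0 H mf f0.
have mfE : measurable_fun setT (EFin \o f : X -> \bar R) by exact/measurable_EFinP.
(* Simple functions increasing to f. *)
pose h := nnsfun_approx measurableT mfE.
have hc x : (h n x)%:E @[n --> \oo] --> (f x)%:E.
  by apply: (cvg_nnsfun_approx measurableT mfE) => // y _; rewrite lee_fin.
have hnd x : {homo (fun n => h n x) : a b / (a <= b)%N >-> a <= b}.
  by move=> a b ab; exact/lefP/nd_nnsfun_approx.
have mhV n : measurable_fun setT (fun w => h n (V w)) by exact: measurableT_comp.
have simple (k : {nnsfun X >-> R}) :
    (\int[Pr]_w (g w * k (V w))%:E = c%:E * \int[Pr]_w (k (V w))%:E)%E.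
  have mk y : measurable (k @^-1` [set y]) by exact: measurable_sfunP.
  have mi y : measurable_fun setT (fun w => \1_(k @^-1` [set y]) (V w) : R).
    by apply: measurableT_comp => //; exact: measurable_indic.
  have k0 y w : 0 <= y * \1_(k @^-1` [set y]) w.
    by exact: nnfun_muleindic_ge0.
  transitivity (\int[Pr]_w \sum_(y \in range k)
      (g w * (y * \1_(k @^-1` [set y]) (V w)))%:E)%E.
    apply: eq_integral => w _; rewrite (fimfunE k (V w)) fsbig_finite//= mulr_sumr -sumEFin.
    by rewrite fsbig_finite.
  rewrite ge0_integral_fsum//; last 2 first.
  - move=> y; apply/measurable_EFinP; apply: measurable_funM => //.
    exact: measurable_funM.
  - by move=> y w _; rewrite lee_fin mulr_ge0.
  transitivity (c%:E * \int[Pr]_w \sum_(y \in range k)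
      (y * \1_(k @^-1` [set y]) (V w))%:E)%E; last first.
    congr (_ * _)%E; apply: eq_integral => w _.
    by rewrite (fimfunE k (V w)) !fsbig_finite//= -sumEFin.
  rewrite ge0_integral_fsum//; last 2 first.
  - by move=> y; apply/measurable_EFinP; exact: measurable_funM.
  - by move=> y w _; rewrite lee_fin.
  rewrite !fsbig_finite//= ge0_sume_distrr; last first.
    by move=> y _; apply: integral_ge0 => w _; rewrite lee_fin.
  apply: eq_big_seq => y; rewrite in_fset_set// => /set_mem[z _ kz].
  have y0 : 0 <= y by rewrite -kz.
  under eq_integral do rewrite mulrCA EFinM.
  under [in RHS]eq_integral do rewrite EFinM.
  rewrite !ge0_integralZl_EFin//; last 3 first.
  - by apply/measurable_EFinP; exact: mi.
  - by move=> w _; rewrite lee_fin mulr_ge0.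
  - by apply/measurable_EFinP; exact: measurable_funM.
  rewrite H// muleCA; congr (_ * (_ * _))%E.
  by rewrite (_ : (fun w => _) = EFin \o \1_(V @^-1` (k @^-1` [set y])))//
    integral_indic ?setIT// -[X in measurable X]setTI; exact: mV.
transitivity (limn (fun n => \int[Pr]_w (g w * h n (V w))%:E)%E).
  rewrite -monotone_convergence//.
  - apply: eq_integral => w _; apply/esym/cvg_lim => //=.
    under eq_fun do rewrite EFinM.
    rewrite EFinM; apply: cvgeZl => //; exact: hc.
  - by move=> n; apply/measurable_EFinP; exact: measurable_funM.
  - by move=> n w _; rewrite lee_fin mulr_ge0.
  - by move=> w _ a b ab; rewrite lee_fin ler_wpM2l// hnd.
under eq_fun do rewrite simple.
have cv : cvgn (fun n => \int[Pr]_w (h n (V w))%:E)%E.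
  apply/ereal_nondecreasing_is_cvgn => a b ab; apply: ge0_le_integral => //.
  - by move=> w _; rewrite lee_fin.
  - exact/measurable_EFinP.
  - exact/measurable_EFinP.
  - by move=> w _; rewrite lee_fin hnd.
rewrite limeMl//; congr (_ * _)%E.
rewrite -monotone_convergence//.
- by apply: eq_integral => w _; apply/cvg_lim => //=; exact: hc.
- by move=> n; exact/measurable_EFinP.
- by move=> n w _; rewrite lee_fin.
- by move=> w _ a b ab; rewrite lee_fin hnd.
Qed.

End IndependentProducts.

Section IndependentSequences.
Context {R : realType} {d dX : measure_display}.
Context {T : measurableType d} {X : measurableType dX}.
Variable Pr : probability T R.

(** Independence on rectangles gives the claim when all F l are indicators; the
indicators are then replaced by arbitrary nonnegative functions one index at a
time, the other factors serving as the density in [integral_weighted]. *)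
Lemma integral_prod_indep (V : nat -> T -> X) (A : set T) N :
  measurable A -> (forall l, measurable_fun setT (V l)) ->
  (forall B : nat -> set X, (forall l, measurable (B l)) ->
    prob Pr (A `&` [set w | forall l : 'I_N, B l (V l w)]) =
    prob Pr A * \prod_(l < N) prob Pr (V l @^-1` B l)) ->
  forall (F : nat -> X -> R) (c : nat -> R),
  (forall l, measurable_fun setT (F l)) -> (forall l x, 0 <= F l x) ->
  (forall l, (\int[Pr]_w (F l (V l w))%:E)%E = (c l)%:E) ->
  (\int[Pr]_w (\1_A w * \prod_(l < N) F l (V l w))%:E)%E =
  (prob Pr A * \prod_(l < N) c l)%:E.
Proof.
move=> mA mV indep.
have mVB l B : measurable B -> measurable (V l @^-1` B).
  by move=> mB; rewrite -[X in measurable X]setTI; exact: mV.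
have intI l B : measurable B ->
    (\int[Pr]_w (\1_B (V l w))%:E = (prob Pr (V l @^-1` B))%:E)%E.
  move=> mB; have mP := mVB l _ mB.
  rewrite -probE// (_ : (fun w => _) = EFin \o \1_(V l @^-1` B))//.
  by rewrite integral_indic// setIT.
(* k counts the indices whose factor is already arbitrary. *)
suff claim k : forall (F : nat -> X -> R) (c : nat -> R),
  (forall l, measurable_fun setT (F l)) -> (forall l x, 0 <= F l x) ->
  (forall l, (\int[Pr]_w (F l (V l w))%:E)%E = (c l)%:E) ->
  (forall l, (k <= l < N)%N -> exists2 B, measurable B & F l = \1_B) ->
  (\int[Pr]_w (\1_A w * \prod_(l < N) F l (V l w))%:E)%E =
  (prob Pr A * \prod_(l < N) c l)%:E.
  move=> F c mF F0 cF; apply: (claim N) => // l /andP[Nl lN].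
  by move: (leq_ltn_trans Nl lN); rewrite ltnn.
elim: k => [|k IH] F c mF F0 cF FI.
  have [B HB] : {B : nat -> set X & forall l, measurable (B l) /\
      ((l < N)%N -> F l = \1_(B l))}.
    apply: (@choice _ _ (fun l B => measurable B /\ ((l < N)%N -> F l = \1_B))) => l.
    case: (ltnP l N) => lN; last by exists set0; split.
    by have [B mB FB] := FI l lN; exists B.
  have mB l : measurable (B l) by case: (HB l).
  have FB (l : 'I_N) : F l = \1_(B l) by case: (HB l) => _ /(_ (ltn_ord l)).
  have -> : (fun w => (\1_A w * \prod_(l < N) F l (V l w))%:E) =
      EFin \o \1_(A `&` [set w | forall l : 'I_N, B l (V l w)]).
    apply/funext => w /=; congr (_ %:E); rewrite indicI; congr (_ * _).
    under eq_bigr do rewrite FB.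
    rewrite [RHS]indicE; have [H|H] := pselect (forall l : 'I_N, B l (V l w)).
      by rewrite mem_set// big1// => l _; rewrite indicE mem_set//; exact: H.
    have [l Bl] : exists l : 'I_N, ~ B l (V l w) by exact/existsNP.
    by rewrite memNset// (bigD1 l)//= indicE memNset// mul0r.
  have mE : measurable (A `&` [set w | forall l : 'I_N, B l (V l w)]).
    apply: measurableI => //.
    rewrite (_ : [set w | _] = \bigcap_(l in [set: 'I_N]) (V l @^-1` B l)); last first.
      by apply/seteqP; split=> [w H l _|w H l]; [exact: H|exact: (H l Logic.I)].
    by apply: fin_bigcap_measurable => // l _; exact: mVB.
  rewrite integral_indic// setIT.
  transitivity (prob Pr (A `&` [set w | forall l : 'I_N, B l (V l w)]))%:E.
    exact: probE.
  rewrite indep//; congr (_ * _)%:E.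
  apply: eq_bigr => l _; apply: EFin_inj; rewrite -intI// -cF.
  by rewrite FB.
have [kN|Nk] := ltnP k N; last first.
  apply: IH => // l /andP[kl lN]; have := leq_ltn_trans kl lN.
  by rewrite ltnNge Nk.
pose o := Ordinal kN.
have c0 l : 0 <= c l.
  rewrite -lee_fin -cF; apply: integral_ge0 => w _.
  by rewrite lee_fin.
have eg (F' : nat -> X -> R) w : \1_A w * \prod_(l < N) F' l (V l w) =
    (\1_A w * \prod_(l < N | l != o) F' l (V l w)) * F' k (V k w) :> R.
  by rewrite (bigD1 o)//= mulrCA mulrC.
have ec (c' : nat -> R) : prob Pr A * \prod_(l < N) c' l =
    (prob Pr A * \prod_(l < N | l != o) c' l) * c' k.
  by rewrite (bigD1 o)//= mulrCA mulrC.
under eq_integral do rewrite eg.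
rewrite ec EFinM -cF; apply: integral_weighted => //.
- apply: measurable_funM; first exact: measurable_indic.
  under eq_fun do rewrite big_mkcond.
  apply: measurable_prod => l _; case: (l != o) => //.
  exact: measurableT_comp.
- by move=> w; rewrite mulr_ge0// prodr_ge0.
- by rewrite mulr_ge0 ?prob_ge0// prodr_ge0.
move=> B mB.
(* The factor number k is put back to an indicator, to which the induction
   hypothesis applies. *)
pose F' l : X -> R := if l == k then \1_B else F l.
pose c' l := if l == k then prob Pr (V k @^-1` B) else c l.
have Fk : F' k = \1_B by rewrite /F' eqxx.
have ck : c' k = prob Pr (V k @^-1` B) by rewrite /c' eqxx.
have := IH F' c' _ _ _ _.
under eq_integral do rewrite eg.
rewrite ec EFinM Fk ck -probE; last exact: mVB.
under eq_integral => w _.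
  under eq_bigr => l lo.
    rewrite /F' (_ : (l == k :> nat) = false); last by apply/negbTE.
    over.
  over.
rewrite [X in (_ * X)%:E](eq_bigr (fun l : 'I_N => c l)); last first.
  by move=> l lo; rewrite /c' (_ : (l == k :> nat) = false)//; exact/negbTE.
apply.
- by move=> l; rewrite /F'; case: eqP => // _; exact: measurable_indic.
- by move=> l x; rewrite /F'; case: eqP => // _; rewrite indicE.
- by move=> l; rewrite /F' /c'; case: eqP => // ->; exact: intI.
- move=> l /andP[]; rewrite leq_eqVlt /F' eq_sym => /orP[/eqP -> _|kl lN].
    by rewrite eqxx; exists B.
  by rewrite (gtn_eqF kl); apply: FI; rewrite kl.
Qed.

End IndependentSequences.

(** * Generating functions *)

Section GeneratingFunctions.
Context {R : realType}.
Local Open Scope ereal_scope.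

(** Truncation of n - t at 0 is harmless because c vanishes there. *)
Lemma gf_shift (c : nat -> R) (y : R) t : (forall k, (0 <= c k)%R) -> c 0%N = 0%R ->
  (0 <= y)%R ->
  \sum_(0 <= n <oo) (c (n - t)%N * y ^+ n)%:E =
  (y ^+ t)%:E * \sum_(0 <= k <oo) (c k * y ^+ k)%:E.
Proof.
move=> c0 c00 y0.
have p k l : 0 <= (c k * y ^+ l)%:E by rewrite lee_fin mulr_ge0// exprn_ge0.
rewrite (nneseries_split 0 t)// big_nat_cond big1 ?add0e; last first.
  move=> k; rewrite andbT => /andP[_]; rewrite add0n => kt.
  by rewrite (_ : (k - t)%N = 0%N) ?c00 ?mul0r//; apply/eqP; rewrite subn_eq0 ltnW.
rewrite add0n -nneseries_addn// -nneseriesZl//; apply: eq_eseriesr => k _.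
by rewrite addnK exprD -EFinM mulrA mulrC.
Qed.

(** All terms are nonnegative, so the sums may be exchanged; for fixed t the sums
over m and n are shifts by t, which contribute x^t y^t to the series in t. *)
Lemma gf_convolution q (a c1 c2 : 'I_q -> nat -> R) (x y : R) (A C1 C2 : 'I_q -> R) :
  (forall i k, (0 <= a i k)%R) -> (forall i k, (0 <= c1 i k)%R) ->
  (forall i k, (0 <= c2 i k)%R) ->
  (forall i, c1 i 0%N = 0%R) -> (forall i, c2 i 0%N = 0%R) ->
  (0 <= x)%R -> (0 <= y)%R ->
  (forall i, \sum_(0 <= t <oo) (a i t * (x * y) ^+ t)%:E = (A i)%:E) ->
  (forall i, \sum_(0 <= k <oo) (c1 i k * x ^+ k)%:E = (C1 i)%:E) ->
  (forall i, \sum_(0 <= k <oo) (c2 i k * y ^+ k)%:E = (C2 i)%:E) ->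
  \sum_(0 <= m <oo) \sum_(0 <= n <oo)
    ((x ^+ m * y ^+ n)%:E * \sum_(0 <= t <oo)
       (\sum_i a i t * (c1 i (m - t)%N * c2 i (n - t)%N))%:E) =
  (\sum_i A i * (C1 i * C2 i))%:E.
Proof.
move=> a0 c10 c20 c100 c200 x0 y0 HA HC1 HC2.
have c1x i m t : (0 <= c1 i t * x ^+ m)%R by rewrite mulr_ge0// exprn_ge0.
have c2y i m t : (0 <= c2 i t * y ^+ m)%R by rewrite mulr_ge0// exprn_ge0.
pose u i t m n : \bar R :=
  (a i t * (c1 i (m - t)%N * x ^+ m) * (c2 i (n - t)%N * y ^+ n))%:E.
have u0 i t m n : 0 <= u i t m n by rewrite lee_fin !mulr_ge0 ?exprn_ge0.
have su0 t m n : 0 <= \sum_i u i t m n by exact: sume_ge0.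
transitivity (\sum_(0 <= m <oo) \sum_(0 <= n <oo) \sum_(0 <= t <oo) \sum_i u i t m n).
  apply: eq_eseriesr => m _; apply: eq_eseriesr => n _.
  rewrite -nneseriesZl; last first.
    by move=> t _; rewrite lee_fin sumr_ge0// => i _; rewrite !mulr_ge0.
  apply: eq_eseriesr => t _; rewrite -EFinM mulr_sumr -sumEFin.
  apply: eq_bigr => i _; congr (_ %:E).
  by ring.
transitivity (\sum_(0 <= t <oo) \sum_(0 <= m <oo) \sum_(0 <= n <oo) \sum_i u i t m n).
  under eq_eseriesr do rewrite nneseries_interchange//.
  rewrite nneseries_interchange// => m t.
  by apply: nneseries_ge0 => n _ _.
have inner i t m : \sum_(0 <= n <oo) u i t m n =
    (a i t * (c1 i (m - t)%N * x ^+ m))%:E * ((y ^+ t)%:E * (C2 i)%:E).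
  rewrite -HC2 -gf_shift// -nneseriesZl; last by move=> n _; rewrite lee_fin.
  by apply: eq_eseriesr => n _; rewrite -EFinM.
have C20 i : (0 <= C2 i)%R.
  by rewrite -lee_fin -HC2; apply: nneseries_ge0 => n _ _; rewrite lee_fin.
have C10 i : (0 <= C1 i)%R.
  by rewrite -lee_fin -HC1; apply: nneseries_ge0 => n _ _; rewrite lee_fin.
have middle i t : \sum_(0 <= m <oo) \sum_(0 <= n <oo) u i t m n =
    (C1 i * C2 i)%:E * (a i t * (x * y) ^+ t)%:E.
  transitivity (\sum_(0 <= m <oo)
      ((a i t * (y ^+ t * C2 i))%:E * (c1 i (m - t)%N * x ^+ m)%:E)).
    by apply: eq_eseriesr => m _; rewrite inner -!EFinM; congr (_ %:E); ring.
  rewrite nneseriesZl; last by move=> m _; rewrite lee_fin.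
  by rewrite gf_shift// HC1 -!EFinM exprMn; congr (_ %:E); ring.
transitivity (\sum_(0 <= t <oo) \sum_i \sum_(0 <= m <oo) \sum_(0 <= n <oo) u i t m n).
  apply: eq_eseriesr => t _.
  under eq_eseriesr do rewrite nneseries_sum//.
  by rewrite nneseries_sum// => i m _; apply: nneseries_ge0.
rewrite nneseries_sum; last first.
  by move=> i t _; apply: nneseries_ge0 => m _ _; apply: nneseries_ge0.
rewrite -sumEFin; apply: eq_bigr => i _.
under eq_eseriesr do rewrite middle.
rewrite nneseriesZl; last by move=> t _; rewrite lee_fin mulr_ge0// exprn_ge0// mulr_ge0.
by rewrite HA -EFinM mulrC.
Qed.

Local Close Scope ereal_scope.

(** A law on the positive integers read off from a sequence indexed from 0 picks
up one factor z. *)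
Lemma gf_delay (b : nat -> R) (c : nat -> R) (z S : R) :
  (forall k, 0 <= b k) -> 0 <= z -> c 0%N = 0 -> (forall k, c k.+1 = b k) ->
  (\sum_(0 <= k <oo) (z ^+ k * b k)%:E = S%:E)%E ->
  (\sum_(0 <= k <oo) (c k * z ^+ k)%:E = (z * S)%:E)%E.
Proof.
move=> b0 z0 c0 cS HS.
have p k : (0 <= (c k * z ^+ k)%:E)%E.
  by case: k => [|k]; rewrite lee_fin ?c0 ?mul0r// cS mulr_ge0// exprn_ge0.
rewrite nneseries_recl// c0 mul0r add0e -nneseries_addn//.
rewrite EFinM -HS -nneseriesZl; last by move=> k _; rewrite lee_fin mulr_ge0// exprn_ge0.
by apply: eq_eseriesr => k _; rewrite addn1 cS exprS -EFinM; congr (_ %:E); ring.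
Qed.

Section CDPH.
Variables (p q : nat) (alpha : 'rV[R]_p) (P : 'M[R]_p) (U : 'M[R]_(p, q)).
Variables (Q1 Q2 : 'M[R]_q).
Hypothesis hparam : cdph_parameters alpha P U Q1 Q2.

Definition resolvent n (M : 'M[R]_n) (z : R) : 'M[R]_n :=
  (\det (1%:M - z *: M))^-1 *: \adj (1%:M - z *: M).

Definition exit_gf (z : R) (i : 'I_q) : R := z * (alpha *m (resolvent P z *m U)) 0 i.

Definition phase_type_gf (Q : 'M[R]_q) (z : R) (i : 'I_q) : R :=
  z * (resolvent Q z *m exit_col Q) i 0.

Lemma row_sum_PU i : \sum_j P i j + \sum_j U i j = 1.
Proof.
case: hparam => _ _ _ [_ /(_ i) <-] _.
rewrite big_split_ord /=; congr (_ + _); apply: eq_bigr => j _.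
  by rewrite row_mxEl.
by rewrite row_mxEr.
Qed.

Lemma exit_law_ge0 i t : 0 <= exit_law alpha P U i t.
Proof.
case: hparam => _ [a0 _] [[P0 _] _ _] [U0 _] _.
case: t => //= t; rewrite -mulmxA mxE sumr_ge0// => l _.
by rewrite mulr_ge0//; exact: expmx_mul_ge0.
Qed.

Lemma exit_col_ge0 (Q : 'M[R]_q) : subprobability_mx Q -> forall i j, 0 <= exit_col Q i j.
Proof. by move=> [_ Q1'] i j; rewrite mxE subr_ge0. Qed.

Lemma phase_type_law_ge0 (Q : 'M[R]_q) i k : subprobability_mx Q -> 0 <= phase_type_law Q i k.
Proof.
move=> sQ; case: k => //= k; apply: expmx_mul_ge0; first by case: sQ.
exact: exit_col_ge0.
Qed.

Lemma exit_lawE z i : 0 <= z <= 1 ->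
  (\sum_(0 <= t <oo) (exit_law alpha P U i t * z ^+ t)%:E = (exit_gf z i)%:E)%E.
Proof.
case: (hparam) => _ [a0 _] [[P0 _] _ _] [U0 _] [tP _ _] z01; have /andP[z0 _] := z01.
apply: (@gf_delay (fun t => exit_law alpha P U i t.+1)) => //.
  by move=> k; exact: exit_law_ge0.
apply: resolvent_series_row => //; first exact: row_sum_PU.
exact: terminating_det_neq0.
Qed.

Lemma phase_type_lawE (Q : 'M[R]_q) z i : subprobability_mx Q -> terminating_mx Q ->
  0 <= z <= 1 ->
  (\sum_(0 <= t <oo) (phase_type_law Q i t * z ^+ t)%:E = (phase_type_gf Q z i)%:E)%E.
Proof.
move=> sQ tQ z01; have /andP[z0 _] := z01.
apply: (@gf_delay (fun t => phase_type_law Q i t.+1)) => //.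
  by move=> k; exact: phase_type_law_ge0.
apply: resolvent_series => //; first by case: sQ.
- exact: exit_col_ge0.
- by move=> l; under [X in _ + X]eq_bigr do rewrite mxE; rewrite big_ord1 addrC subrK.
- exact: terminating_det_neq0.
Qed.

(** The product of x and y again takes its values in [0, 1], so that all three
resolvents stay away from their poles. *)
Lemma cdph_gf_rational (x y : R -> R -> R) : rational2 x -> rational2 y ->
  (forall s t, 0 <= s -> 0 <= t -> 0 <= x s t <= 1) ->
  (forall s t, 0 <= s -> 0 <= t -> 0 <= y s t <= 1) ->
  rational2 (fun s t => \sum_i exit_gf (x s t * y s t) i *
    (phase_type_gf Q1 (x s t) i * phase_type_gf Q2 (y s t) i)).
Proof.
case: hparam => _ _ _ _ [tP tQ1 tQ2] Hx Hy x01 y01.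
have Hxy := rational2M Hx Hy.
have Hres n (M : 'M[R]_n) z : rational2 z -> terminating_mx M ->
    (forall s t, 0 <= s -> 0 <= t -> 0 <= z s t <= 1) ->
    rational2_mx (fun s t => resolvent M (z s t)).
  move=> Hz tM z01; apply: rational2_invmx; first exact: rational2_resolvent.
  by move=> s t s0 t0; apply: terminating_det_neq0 => //; exact: z01.
apply: rational2_sum => i; apply: rational2M.
  apply: rational2M => //; apply: rational2_mulmx; first exact: rational2_mxcst.
  apply: rational2_mulmx; last exact: rational2_mxcst.
  apply: Hres => // s t s0 t0.
  have /andP[? ?] := x01 s t s0 t0; have /andP[? ?] := y01 s t s0 t0.
  by rewrite mulr_ge0// mulr_ile1.
apply: rational2M; apply: rational2M => //; apply: rational2_mulmx;
  by [exact: rational2_mxcst|exact: Hres].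
Qed.

End CDPH.
End GeneratingFunctions.

(** * Laplace transforms of random sums *)

Section Laws.
Context {R : realType}.

(** Both integrals are the integral of f against the common image measure. *)
Lemma integral_eq_law d1 d2 dX (T1 : measurableType d1) (T2 : measurableType d2)
    (X : measurableType dX) (P1 : probability T1 R) (P2 : probability T2 R)
    (V1 : T1 -> X) (V2 : T2 -> X) (f : X -> R) :
  measurable_fun setT V1 -> measurable_fun setT V2 ->
  (forall B, measurable B -> P1 (V1 @^-1` B) = P2 (V2 @^-1` B)) ->
  measurable_fun setT f -> (forall x, 0 <= f x) ->
  (\int[P1]_w (f (V1 w))%:E = \int[P2]_w (f (V2 w))%:E)%E.
Proof.
move=> m1 m2 H mf f0.
pose W1 : {mfun T1 >-> X} := HB.pack V1 (isMeasurableFun.Build _ _ _ _ _ m1).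
pose W2 : {mfun T2 >-> X} := HB.pack V2 (isMeasurableFun.Build _ _ _ _ _ m2).
have mfE : measurable_fun setT (EFin \o f : X -> \bar R) by exact/measurable_EFinP.
have f0E : {in setT, forall y, (0 <= (EFin \o f) y)%E} by move=> x _; rewrite lee_fin.
have e1 := ge0_integral_pushforward m1 P1 measurableT mfE f0E.
have e2 := ge0_integral_pushforward m2 P2 measurableT mfE f0E.
rewrite !preimage_setT in e1 e2.
transitivity (\int[pushforward P1 W1]_y (EFin \o f) y)%E; first by rewrite e1.
transitivity (\int[pushforward P2 W2]_y (EFin \o f) y)%E; last by rewrite e2.
by apply: eq_measure_integral => B mB _; exact: H.
Qed.

Section LaplaceTransform.
Context {d : measure_display} {T : measurableType d} (Pr : probability T R).

Lemma measurable_expR_scale (a : R) : measurable_fun setT (fun x : R => expR (- a * x)).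
Proof.
apply: measurableT_comp; first exact: measurable_expR.
exact: measurable_funM.
Qed.

Lemma laplace_bounds (X : T -> R) (a phi : R) : measurable_fun setT X ->
  {ae Pr, forall w, 0 < X w} -> 0 <= a ->
  (\int[Pr]_w (expR (- a * X w))%:E)%E = phi%:E -> 0 <= phi <= 1.
Proof.
move=> mX X0 a0 E; apply/andP; split; rewrite -lee_fin -E.
  by apply: integral_ge0 => w _; rewrite lee_fin expR_ge0.
have -> : 1%:E = (\int[Pr]_w 1)%E.
  by rewrite integral_cst// mul1e; exact/esym/(probability_setT Pr).
apply: ae_ge0_le_integral => //.
- by apply/measurable_EFinP; exact: (measurableT_comp (measurable_expR_scale a) mX).
- case: X0 => N [mN N0 HN]; exists N; split=> // w /= H; apply: HN => /= X0; apply: H => _.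
  by rewrite lee_fin expR_le1 mulNr oppr_le0 mulr_ge0// ltW.
Qed.

Lemma laplace_indep2 (X1 X2 : T -> R) (a b phi1 phi2 : R) :
  measurable_fun setT X1 -> measurable_fun setT X2 ->
  independent2 Pr (sigma_rv X1) (sigma_rv X2) ->
  (\int[Pr]_w (expR (- a * X1 w))%:E)%E = phi1%:E ->
  (\int[Pr]_w (expR (- b * X2 w))%:E)%E = phi2%:E ->
  (\int[Pr]_w (expR (- a * X1 w - b * X2 w))%:E)%E = (phi1 * phi2)%:E.
Proof.
move=> m1 m2 ind E1 E2.
pose V l := if l is 0%N then X1 else X2.
pose F l : R -> R := if l is 0%N then (fun x => expR (- a * x)) else (fun x => expR (- b * x)).
pose c l : R := if l is 0%N then phi1 else phi2.
have mV l : measurable_fun setT (V l) by case: l.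
have mVB l B : measurable B -> measurable (V l @^-1` B).
  by move=> mB; rewrite -[X in measurable X]setTI; exact: mV.
have := @integral_prod_indep _ _ _ _ _ Pr V setT 2 measurableT mV _ F c.
under eq_integral => w _.
  rewrite indicT big_ord_recl big_ord1 /= mul1r -expRD [- b * _]mulNr.
  over.
move=> -> //.
- by rewrite big_ord_recl big_ord1 /= /prob probability_setT mul1r.
- move=> B mB; rewrite setTI /prob probability_setT mul1r big_ord_recl big_ord1 /=.
  rewrite -fineM ?fin_num_measure//; last 2 first.
  + exact: (mVB 0%N).
  + exact: (mVB 1%N).
  rewrite -ind; last 2 first.
  + by exists (B 0%N) => //; rewrite setTI.
  + by exists (B 1%N) => //; rewrite setTI.
  congr (fine (Pr _)); apply/seteqP; split=> [w H|w [H0 H1] l].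
    by split; [exact: (H ord0)|exact: (H (lift ord0 ord0))].
  by case: l => -[|[|//]] /= _.
- by case=> *; exact: measurable_expR_scale.
- by move=> l x; case: l => [|l]; rewrite expR_ge0.
- by case.
Qed.

End LaplaceTransform.
End Laws.

Section RandomSums.
Context {R : realType} {d d0 : measure_display} {T : measurableType d}.
Context {T0 : measurableType d0} (Pr : probability T R) (Pr0 : probability T0 R).

(** The rectangle built from the first N variables lies in the sigma-algebra of
the whole sequence, hence is independent of tau; mutual independence splits it
into its sides. *)
Lemma iid_prob_rect (dX : measure_display) (X : measurableType dX)
    dY (Y : measurableType dY) (tau : T -> Y) (V : nat -> T -> X) (C : set Y) N :
  mutually_independent Pr (fun l => sigma_rv (V l)) ->
  independent2 Pr (sigma_rv tau) (sigma_seq V) ->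
  measurable C -> measurable_fun setT tau -> (forall l, measurable_fun setT (V l)) ->
  forall B : nat -> set X, (forall l, measurable (B l)) ->
    prob Pr (tau @^-1` C `&` [set w | forall l : 'I_N, B l (V l w)]) =
    prob Pr (tau @^-1` C) * \prod_(l < N) prob Pr (V l @^-1` B l).
Proof.
move=> ind indt mC mtau mV B mB.
have mVB l D : measurable D -> measurable (V l @^-1` D).
  by move=> mD; rewrite -[X in measurable X]setTI; exact: mV.
pose G := [set w | forall l : 'I_N, B l (V l w)].
have GE : G = \bigcap_(i in [set` iota 0 N]) (V i @^-1` B i).
  apply/seteqP; split=> [w H i /=|w H l].
    by rewrite mem_iota add0n => /andP[_ iN]; exact: (H (Ordinal iN)).
  by apply: H; rewrite /= mem_iota add0n ltn_ord.
have sG : sigma_seq V G.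
  (* A finite intersection through the closure properties of a sigma-algebra,
     which are complements and countable unions. *)
  have -> : G = ~` \bigcup_l (if (l < N)%N then ~` (V l @^-1` B l) else set0).
    apply/seteqP; split=> [w H [l _]|w H l].
      by case: ifP => // lN; apply; exact: (H (Ordinal lN)).
    by apply: contrapT => nB; apply: H; exists l => //; rewrite ltn_ord.
  apply: sigma_algebraC; apply: sigma_algebra_bigcup => l.
  case: ifP => _; last exact: sigma_algebra0.
  apply: sigma_algebraC; apply: sub_sigma_algebra; exists l => //.
  by exists (B l) => //; rewrite setTI.
have PG : Pr G = (\prod_(l < N) prob Pr (V l @^-1` B l))%:E.
  rewrite GE ind ?iota_uniq//; last first.
    by move=> i _; exists (B i) => //; rewrite setTI.
  rewrite -{1}[N]subn0 -/(index_iota 0 N) big_mkord -prodEFin.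
  by apply: eq_bigr => l _; rewrite probE//; exact: mVB.
apply: EFin_inj; rewrite EFinM -PG.
have mt : measurable (tau @^-1` C) by rewrite -[X in measurable X]setTI; exact: mtau.
have mG : measurable G.
  by rewrite GE; apply: fin_bigcap_measurable => // i _; exact: mVB.
rewrite -!probE//; last exact: measurableI.
by apply: indt => //; exists C => //; rewrite setTI.
Qed.

Lemma measurable_random_sum (tau : T -> nat) (X : nat -> T -> R) :
  measurable_fun setT tau -> (forall l, measurable_fun setT (X l)) ->
  measurable_fun setT (fun w => \sum_(l < tau w) X l w).
Proof.
move=> mt mX _ B mB; rewrite setTI.
rewrite (_ : _ @^-1` B = \bigcup_m (tau @^-1` [set m] `&`
    (fun w => \sum_(l < m) X l w) @^-1` B)); last first.
  apply/seteqP; split=> [w Bw|w [m _ [/= <-]]//].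
  by exists (tau w).
apply: bigcup_measurable => m _; apply: measurableI.
  by rewrite -[X in measurable X]setTI; exact: mt.
rewrite -[X in measurable X]setTI.
have mS : measurable_fun setT (fun w => \sum_(l < m) X l w) by exact: measurable_sum.
exact: mS.
Qed.

Variables (tau1 tau2 : T -> nat).
Hypothesis mt1 : measurable_fun setT tau1.
Hypothesis mt2 : measurable_fun setT tau2.

Lemma integral_partition_nat2 (f : T -> R) : measurable_fun setT f ->
  (forall w, 0 <= f w) ->
  (\int[Pr]_w (f w)%:E = \sum_(0 <= m <oo) \sum_(0 <= n <oo)
    \int[Pr]_w (\1_[set w | (tau1 w, tau2 w) = (m, n)] w * f w)%:E)%E.
Proof.
move=> mf f0.
have mE1 m : measurable (tau1 @^-1` [set m]).
  by rewrite -[X in measurable X]setTI; exact: mt1.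
have mE2 m : measurable (tau2 @^-1` [set m]).
  by rewrite -[X in measurable X]setTI; exact: mt2.
have mfE D : measurable_fun D (EFin \o f : T -> \bar R).
  by apply/measurable_EFinP; exact: measurable_funTS.
have U1 : [set: T] = \bigcup_m (tau1 @^-1` [set m]).
  by apply/seteqP; split=> // w _; exists (tau1 w).
rewrite {1}U1 ge0_integral_bigcup//; last 2 first.
- by move=> w _; rewrite lee_fin.
- exact: trivIset_preimage1.
apply: eq_eseriesr => m _.
have U2 : tau1 @^-1` [set m] =
    \bigcup_n (tau1 @^-1` [set m] `&` tau2 @^-1` [set n]).
  by apply/seteqP; split=> [w ?|w [n _ []]//]; exists (tau2 w).
rewrite {1}U2 ge0_integral_bigcup//; last 3 first.
- by move=> n; exact: measurableI.
- by move=> w _; rewrite lee_fin.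
- by move=> x y _ _ [w [[_ /= <-] [_ /= <-]]].
apply: eq_eseriesr => n _.
rewrite integral_mkcond; apply: eq_integral => w _.
rewrite patchE indicE; congr (_ : \bar R).
have -> : (w \in tau1 @^-1` [set m] `&` tau2 @^-1` [set n]) =
    (w \in [set w | (tau1 w, tau2 w) = (m, n)]).
  by apply/idP/idP => /set_mem H; apply/mem_set; move: H => /= [-> ->].
by case: ifP => _; rewrite ?mul1r ?mul0r.
Qed.

Variables (X1 X2 : T0 -> R) (Xs1 Xs2 : nat -> T -> R).
Hypothesis mX1 : measurable_fun setT X1.
Hypothesis mX2 : measurable_fun setT X2.
Hypothesis mXs1 : forall l, measurable_fun setT (Xs1 l).
Hypothesis mXs2 : forall l, measurable_fun setT (Xs2 l).
Hypothesis hiid : iid_copies Pr Pr0 (fun l w => (Xs1 l w, Xs2 l w))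
                            (fun w => (X1 w, X2 w)).
Hypothesis hindep : independent2 Pr (sigma_rv (fun w => (tau1 w, tau2 w)))
              (sigma_seq (fun l w => (Xs1 l w, Xs2 l w))).
Hypothesis hX : independent2 Pr0 (sigma_rv X1) (sigma_rv X2).

(** On {tau1 = m, tau2 = n} the integrand is a product over l < m + n of functions
of the l-th copy alone, where the exponent of the first coordinate is switched
off for l >= m and that of the second one for l >= n.  This uniform description
avoids comparing m and n; a factor that is switched off has expectation 1. *)
Lemma laplace_random_sums (a b x y : R) :
  (\int[Pr0]_w (expR (- a * X1 w))%:E)%E = x%:E ->
  (\int[Pr0]_w (expR (- b * X2 w))%:E)%E = y%:E ->
  (\int[Pr]_w (expR (- a * (\sum_(l < tau1 w) Xs1 l w)
                     - b * (\sum_(l < tau2 w) Xs2 l w)))%:E =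
   \sum_(0 <= m <oo) \sum_(0 <= n <oo)
    ((x ^+ m * y ^+ n)%:E * Pr [set w | tau1 w = m /\ tau2 w = n]))%E.
Proof.
move=> Ex Ey.
have mY1 := measurable_random_sum mt1 mXs1.
have mY2 := measurable_random_sum mt2 mXs2.
rewrite integral_partition_nat2//; last first.
  apply: measurableT_comp; first exact: measurable_expR.
  by apply: measurable_funB; exact: measurable_funM.
apply: eq_eseriesr => m _; apply: eq_eseriesr => n _.
set A := [set w | _ = _].
have mt : measurable_fun setT (fun w => (tau1 w, tau2 w)) by exact: measurable_fun_pair.
pose C := [set m] `*` [set n].
have mC : measurable C by exact: measurableX.
have AC : A = (fun w => (tau1 w, tau2 w)) @^-1` C.
  by apply/seteqP; split=> w; rewrite /A /C /= => -[-> ->].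
have mA : measurable A by rewrite AC -[X in measurable X]setTI; exact: mt.
have -> : [set w | tau1 w = m /\ tau2 w = n] = A.
  by apply/seteqP; split=> w; rewrite /A /= => -[-> ->].
pose aa l := if (l < m)%N then a else 0.
pose bb l := if (l < n)%N then b else 0.
pose F l (z : R * R) := expR (- aa l * z.1 - bb l * z.2).
pose V l w := (Xs1 l w, Xs2 l w).
have mV l : measurable_fun setT (V l) by exact: measurable_fun_pair.
pose c l := (if (l < m)%N then x else 1) * (if (l < n)%N then y else 1).
have mF l : measurable_fun setT (F l).
  apply: measurableT_comp; first exact: measurable_expR.
  apply: measurable_funB; apply: measurable_funM => //.
have int0 (Z : T0 -> R) : (\int[Pr0]_w (expR (- 0 * Z w))%:E)%E = 1%:E.
  under eq_integral do rewrite oppr0 mul0r expR0.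
  by rewrite integral_cst// mul1e; exact: (probability_setT Pr0).
have cF l : (\int[Pr]_w (F l (V l w))%:E)%E = (c l)%:E.
  rewrite (@integral_eq_law _ _ _ _ _ _ _ _ Pr0 _ (fun w => (X1 w, X2 w)))//.
  - apply: laplace_indep2 => //.
      by rewrite /aa; case: ifP.
    by rewrite /bb; case: ifP.
  - exact: measurable_fun_pair.
  - by case: hiid => _ /(_ l).
  - by move=> z; rewrite expR_ge0.
have pw (u : R) k N : (k <= N)%N -> \prod_(l < N) (if (l < k)%N then u else 1) = u ^+ k.
  move=> kN; rewrite -big_mkcond -(big_ord_widen N (fun=> u) kN).
  by rewrite prodr_const card_ord.
have sw (u : R) (Y : nat -> R) k N : (k <= N)%N ->
    u * (\sum_(l < k) Y l) = \sum_(l < N) (if (l < k)%N then u else 0) * Y l.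
  move=> kN; rewrite mulr_sumr (big_ord_widen N (fun l => u * Y l) kN) big_mkcond.
  by apply: eq_bigr => l _; case: ifP; rewrite ?mul0r.
have cE : \prod_(l < m + n) c l = x ^+ m * y ^+ n.
  by rewrite big_split /= !pw ?leq_addr ?leq_addl.
have indB (B : nat -> set (R * R)%type) : (forall l, measurable (B l)) ->
    prob Pr (A `&` [set w | forall l : 'I_(m + n), B l (V l w)]) =
    prob Pr A * \prod_(l < m + n) prob Pr (V l @^-1` B l).
  rewrite AC; exact: (iid_prob_rect (m + n)%N (proj1 hiid) hindep mC mt mV).
have F0 l z : 0 <= F l z by rewrite expR_ge0.
rewrite probE// -EFinM mulrC -cE -(integral_prod_indep mA mV indB mF F0 cF).
apply: eq_integral => w _; congr (_ %:E).
rewrite [LHS]/= indicE; have [/set_mem wA|wA] := boolP (w \in A); last by rewrite !mul0r.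
rewrite !mul1r -expR_sum; congr expR.
case: wA => -> ->; rewrite sumrB; congr (_ - _).
  rewrite mulNr (sw _ (Xs1 ^~ w) m (m + n)%N) ?leq_addr// -sumrN.
  by apply: eq_bigr => l _; rewrite mulNr.
by rewrite (sw _ (Xs2 ^~ w) n (m + n)%N) ?leq_addl.
Qed.

End RandomSums.

Lemma ae_eq_law (R : realType) d1 d2 dX (T1 : measurableType d1) (T2 : measurableType d2)
    (X : measurableType dX) (P1 : probability T1 R) (P2 : probability T2 R)
    (V1 : T1 -> X) (V2 : T2 -> X) (B : set X) :
  measurable_fun setT V1 -> measurable_fun setT V2 ->
  (forall B, measurable B -> P1 (V1 @^-1` B) = P2 (V2 @^-1` B)) ->
  measurable B -> {ae P2, forall w, B (V2 w)} -> {ae P1, forall w, B (V1 w)}.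
Proof.
move=> m1 m2 H mB aeB; have mC := measurableC mB.
have m1C : measurable (V1 @^-1` (~` B)) by rewrite -[X in measurable X]setTI; exact: m1.
have m2C : measurable (V2 @^-1` (~` B)) by rewrite -[X in measurable X]setTI; exact: m2.
apply/(negligibleP _ m1C); rewrite [LHS]H//.
exact/(negligibleP P2 m2C).
Qed.

Unset Implicit Arguments.

Theorem corollary3p2 (R : realType) (p q : nat)
  (alpha : 'rV[R]_p) (P : 'M[R]_p) (U : 'M[R]_(p, q)) (Q1 Q2 : 'M[R]_q)
  (hparam : cdph_parameters alpha P U Q1 Q2)
  (d d0 : measure_display) (T : measurableType d) (T0 : measurableType d0)
  (Pr : probability T R) (Pr0 : probability T0 R)
  (tau1 tau2 : {RV Pr >-> nat})
  (htau : cdph tau1 tau2 alpha P U Q1 Q2)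
  (X1 X2 : {RV Pr0 >-> R})
  (Xs1 Xs2 : nat -> {RV Pr >-> R})
  (hiid : iid_copies Pr Pr0 (fun l w => (Xs1 l w, Xs2 l w))
                            (fun w => (X1 w, X2 w)))
  (hindep : independent2 Pr (sigma_rv (fun w => (tau1 w, tau2 w)))
              (sigma_seq (fun l w => (Xs1 l w, Xs2 l w))))
  (hX1 : matrix_exponential Pr0 X1)
  (hX2 : matrix_exponential Pr0 X2)
  (hX : independent2 Pr0 (sigma_rv X1) (sigma_rv X2)) :
  MME Pr (fun w => \sum_(l < tau1 w) Xs1 l w)
         (fun w => \sum_(l < tau2 w) Xs2 l w).
Proof.
have [mX1 X10 [n1 [d1 H1]]] := hX1.
have [mX2 X20 [n2 [d2 H2]]] := hX2.
have mXs1 l : measurable_fun setT (Xs1 l) by exact: measurable_funPT.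
have mXs2 l : measurable_fun setT (Xs2 l) by exact: measurable_funPT.
have mt1 : measurable_fun setT tau1 by exact: measurable_funPT.
have mt2 : measurable_fun setT tau2 by exact: measurable_funPT.
pose x (s t : R) := n1.[s] / d1.[s]; pose y (s t : R) := n2.[t] / d2.[t].
have Ex s : 0 <= s -> (\int[Pr0]_w (expR (- s * X1 w))%:E)%E = (n1.[s] / d1.[s])%:E.
  by move=> /H1[_ <-]; rewrite unlock.
have Ey s : 0 <= s -> (\int[Pr0]_w (expR (- s * X2 w))%:E)%E = (n2.[s] / d2.[s])%:E.
  by move=> /H2[_ <-]; rewrite unlock.
have rx : rational2 x.
  by apply: (@rational2_fst _ _ n1 d1) => s /H1[].
have ry : rational2 y.
  by apply: (@rational2_snd _ _ n2 d2) => s /H2[].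
have x01 s t : 0 <= s -> 0 <= t -> 0 <= x s t <= 1.
  by move=> s0 _; exact: (laplace_bounds mX1 X10 s0 (Ex s s0)).
have y01 s t : 0 <= s -> 0 <= t -> 0 <= y s t <= 1.
  by move=> _ t0; exact: (laplace_bounds mX2 X20 t0 (Ey t t0)).
have mV l : measurable_fun setT (fun w => (Xs1 l w, Xs2 l w)) by exact: measurable_fun_pair.
have mV0 : measurable_fun setT (fun w => (X1 w, X2 w)) by exact: measurable_fun_pair.
split.
- split; first exact: (measurable_random_sum mt1 mXs1).
  exact: (measurable_random_sum mt2 mXs2).
- have mpos : measurable [set r : R | 0 < r].
    rewrite (_ : [set r | _] = `]0, +oo[%classic)//.
    by apply/seteqP; split=> r; rewrite /= in_itv /= andbT.
  have mpos1 : measurable [set z : R * R | 0 < z.1].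
    by rewrite -[X in measurable X]setTI; exact: (measurable_fst _ _ mpos).
  have mpos2 : measurable [set z : R * R | 0 < z.2].
    by rewrite -[X in measurable X]setTI; exact: (measurable_snd _ _ mpos).
  have ae1 : {ae Pr, forall w, forall l, 0 < Xs1 l w}.
    apply: ae_foralln => l.
    exact: (ae_eq_law (mV l) mV0 (proj2 hiid l) mpos1 X10).
  have ae2 : {ae Pr, forall w, forall l, 0 < Xs2 l w}.
    apply: ae_foralln => l.
    exact: (ae_eq_law (mV l) mV0 (proj2 hiid l) mpos2 X20).
  apply: filterS2 ae1 ae2 => w w1 w2.
  by split; apply: sumr_ge0 => l _; exact: ltW.
have [num [den H]] := cdph_gf_rational hparam rx ry x01 y01.
exists num, den => s t s0 t0; have [den0 <-] := H s t s0 t0; split=> //.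
rewrite unlock.
rewrite (laplace_random_sums mt1 mt2 mX1 mX2 mXs1 mXs2 hiid hindep hX (Ex s s0) (Ey t t0)).
have [d' [T' [Pr' [M1 [M2 [chains law]]]]]] := htau.
have [_ [_ alpha1] [_ sQ1 sQ2] _ [_ tQ1 tQ2]] := hparam.
have /andP[x0 x1] := x01 s t s0 t0; have /andP[y0 y1] := y01 s t s0 t0.
rewrite -(gf_convolution (a := exit_law alpha P U) (c1 := phase_type_law Q1)
  (c2 := phase_type_law Q2) (x := x s t) (y := y s t)) //.
- apply: eq_eseriesr => m _; apply: eq_eseriesr => n _.
  by rewrite law (joint_law alpha1 (row_sum_PU hparam) chains).
- by move=> i k; exact: (exit_law_ge0 hparam).
- by move=> i k; exact: phase_type_law_ge0.
- by move=> i k; exact: phase_type_law_ge0.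
- by move=> i; apply: (exit_lawE hparam); rewrite mulr_ge0// mulr_ile1.
- by move=> i; apply: phase_type_lawE => //; rewrite x0.
- by move=> i; apply: phase_type_lawE => //; rewrite y0.
Qed.
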